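(* Let $H$ be a $(d,r)$-regular hypergraph, let $\tau_H=\min\{\nu(H),e(H)\}$, and let $\mu_{\tau_H}(B_H)$ be the $\tau_H$-th largest root (counted with multiplicity) of the matching polynomial $\mu_{B_H}(x)$ of the incidence graph $B_H$ of $H$. If $$\mu_{\tau_H}(B_H)\ge\left|\sqrt{d-1}-\sqrt{r-1}\right|,$$ then $H$ has a left-sided Ramanujan $2$-covering.
   Context: A hypergraph $H=(V,E)$ has a finite vertex set and a finite family of subsets of $V$ (edges); $\nu(H)=|V|$, $e(H)=|E|$. It is $(d,r)$-regular if every edge has $r\ge2$ vertices and every vertex lies in exactly $d$ edges. The adjacency matrix $A(H)$ has $(u,v)$-entry the number of edges containing both $u,v$ for $u\ne v$, and $0$ on the diagonal. The incidence graph $B_H$ is the bipartite graph on $V\cup E$ with $v\sim e$ iff $v\in e$. For a graph $G$ on $n$ vertices, with $m_i$ the number of sets of $i$ pairwise disjoint edges ($m_0=1$), the matching polynomial is $\mu_G(x)=\sum_{i\ge0}(-1)^i m_i x^{n-2i}$ (all its roots are real). A $2$-cover of $H$ is a hypergraph $\bar H$ with a surjective map $\varpi:V(\bar H)\to V(H)$ such that every vertex of $H$ has exactly two preimages, every edge of $\bar H$ is mapped bijectively onto an edge of $H$, and for each $\bar v\in V(\bar H)$ the induced map from edges of $\bar H$ containing $\bar v$ to edges of $H$ containing $\varpi(\bar v)$ is a bijection. The eigenvalue multiset of $A(\bar H)$ contains that of $A(H)$; the new eigenvalues are the multiset difference, listed as $\theta_1\ge\theta_2\ge\cdots\ge\theta_{\nu(H)}$.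 (If $d<r$ the value $-d$ appears $\nu(H)-e(H)$ times among them as ''obvious'' eigenvalues, these being the smallest ones.) $\bar H$ is a left-sided Ramanujan $2$-covering of $H$ if every non-obvious new eigenvalue is at least $r-2-2\sqrt{(d-1)(r-1)}$, i.e. $\theta_{\tau_H}\ge r-2-2\sqrt{(d-1)(r-1)}$. *)

(* Defs.v *)
From HB Require Import structures.
From mathcomp Require Import all_boot all_order all_algebra.
From mathcomp Require Import polyrcf reals.

Set Implicit Arguments.
Unset Strict Implicit.
Unset Printing Implicit Defensive.

Import Order.TTheory GRing.Theory Num.Theory.
Local Open Scope ring_scope.

(* E(H) is a finite family of subsets of V(H): edges are indexed by a finite
   type, so repeated edges are allowed. *)
Record hypergraph := Hypergraph {
  vertex : finType;
  edge : finType;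
  verts : edge -> {set vertex} }.

Section Hypergraphs.

Implicit Type H : hypergraph.

Definition nu H : nat := #|vertex H|.
Definition ne H : nat := #|edge H|.
Definition tau H : nat := minn (nu H) (ne H).

Definition star H (v : vertex H) : {set edge H} := [set e | v \in verts e].

Definition regular (d r : nat) H : Prop :=
  [/\ (2 <= r)%N,
      forall e : edge H, #|verts e| = r &
      forall v : vertex H, #|star v| = d].

Definition adjacency (R : nzRingType) H : 'M[R]_(nu H) :=
  \matrix_(i, j) if i == j then 0
                 else #|star (enum_val i) :&: star (enum_val j)|%:R.

Definition incidence_graph H : rel (vertex H + edge H) := fun x y =>
  match x, y with
  | inl v, inr e => v \in verts e
  | inr e, inl v => v \in verts e
  | _, _ => false
  end.

Lemma incidence_graph_sym H : symmetric (@incidence_graph H).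
Proof. by case=> [v|e] [w|f]. Qed.

Lemma incidence_graph_irr H : irreflexive (@incidence_graph H).
Proof. by case. Qed.

(* The induced map phi on edges is part of the data because two edges may have
   the same vertex set; without repeated edges it is determined by p. *)
Definition is_2cover (Hbar H : hypergraph)
    (p : vertex Hbar -> vertex H) (phi : edge Hbar -> edge H) : Prop :=
  [/\ forall v : vertex H, exists vb, p vb = v,
      forall v : vertex H, #|[set vb | p vb == v]| = 2%N,
      forall eb : edge Hbar,
        {in verts eb &, injective p} /\ p @: verts eb = verts (phi eb) &
      forall vb : vertex Hbar,
        {in star vb &, injective phi} /\ phi @: star vb = star (p vb)].

End Hypergraphs.

Section MatchingPolynomial.

(* A graph is a symmetric irreflexive relation g on a finite type T; its edges
   are the pairs {x, y} with g x y. *)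
Variables (T : finType) (g : rel T).

Definition graph_edges : {set {set T}} :=
  [set [set xy.1; xy.2] | xy in [set xy : T * T | g xy.1 xy.2]].

Definition matchings (i : nat) : {set {set {set T}}} :=
  [set M : {set {set T}} | [&& M \subset graph_edges, trivIset M & #|M| == i]].

(* There is no matching of size i > #|T| / 2. *)
Definition matching_poly (R : nzRingType) : {poly R} :=
  \sum_(i < (#|T|./2).+1)
    ((-1) ^+ i * #|matchings i|%:R) *: 'X^(#|T| - 2 * i).

End MatchingPolynomial.

Section Roots.

Variable R : rcfType.

(* All roots in R, with multiplicity, in nonincreasing order (rootsR lists the
   distinct roots). *)
Definition real_roots (p : {poly R}) : seq R :=
  sort >=%R (flatten [seq nseq (mup x p) x | x <- rootsR p]).

(* k is counted from 1 *)
Definition kth_largest_root (p : {poly R}) (k : nat) : R :=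
  nth 0 (real_roots p) k.-1.

Definition spectrum (n : nat) (A : 'M[R]_n) : seq R :=
  real_roots (char_poly A).

(* Multiset difference; the order of s is kept. *)
Definition seq_diff (s t : seq R) : seq R := foldr (fun x u => rem x u) s t.

(* theta_1 >= theta_2 >= ... *)
Definition new_eigenvalues (Hbar H : hypergraph) : seq R :=
  seq_diff (spectrum (adjacency R Hbar)) (spectrum (adjacency R H)).

(* For a (d, r)-regular H with d < r one has tau H = ne H, and the obvious new
   eigenvalues are the nu H - ne H last ones; otherwise tau H = nu H and none
   is obvious. *)
Definition nonobvious_new_eigenvalues (Hbar H : hypergraph) : seq R :=
  take (tau H) (new_eigenvalues Hbar H).

Definition left_sided_Ramanujan_2covering (d r : nat) (Hbar H : hypergraph)
    (p : vertex Hbar -> vertex H) (phi : edge Hbar -> edge H) : Prop :=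
  is_2cover p phi /\
  forall theta, theta \in nonobvious_new_eigenvalues Hbar H ->
    r%:R - 2 - 2 * Num.sqrt ((d%:R - 1) * (r%:R - 1)) <= theta.

End Roots.

(* Main.v *)
Require Import Defs.
From HB Require Import structures.
From mathcomp Require Import all_boot all_order all_algebra.
From mathcomp Require Import polyrcf reals.
From mathcomp Require Import perm complex boolp ring lra zify.

Set Implicit Arguments.
Unset Strict Implicit.
Unset Printing Implicit Defensive.

Import Order.TTheory GRing.Theory Num.Theory.
Local Open Scope ring_scope.

(** Signing the incidences of H gives a 2-cover whose new eigenvalues are those
    of [N N^T - d], where N is the signed incidence matrix. Summed over all
    signings, [det (x + N N^T)] (or [det (x + N^T N)] if there are fewer edges
    than vertices) is, up to a positive constant, the polynomial
    [\sum_A x^(tau - |A|)] over the matchings A of the incidence graph, and the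
    hypothesis on the matching polynomial makes it positive for
    [x > - (sqrt (d - 1) - sqrt (r - 1))^2]. It remains to find one signing with
    the same positivity. The columns of N are independent random vectors v, so
    they can be fixed one at a time: if a is the sum over the later columns
    before the rank-one update and a + b_v the one after it, then b_v / a maps
    the upper half-plane to the closed lower one (the sums do not vanish on
    matrices with positive definite imaginary part, and are affine along
    rank-one directions). Hence a is real-rooted, b_v / a has simple poles
    with nonnegative residues, the roots of a interlace those of every a + b_v
    simultaneously, and the largest root of one of the a + b_v is at most that
    of their sum. *)

(** * Sums of determinants over rank-one updates *)

Definition rank1 (R : comNzRingType) n (v : 'rV[R]_n) : 'M[R]_n := v^T *m v.

(** Up to the number of choices, the expectation of [\det] after independent random rank-one
    updates; the recursion lets them be fixed one at a time. *)
Fixpoint mixed_det (R : comNzRingType) n (L : seq (seq 'rV[R]_n)) (M : 'M[R]_n) : R :=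
  if L is V :: L' then \sum_(v <- V) mixed_det L' (M + rank1 v) else \det M.

Section RankOne.
Variable R : comNzRingType.
Implicit Types (n : nat) (z : R).

(** The bordered determinant replaces an argument with the inverse of [M]: by a Schur complement it
    is [\det (M + w^T *m v)] at [a = 1], and it is linear in the border row. *)
Let bdet n (M : 'M[R]_n) (a : R) (v w : 'rV[R]_n) : R :=
  \det (block_mx a%:M (- v) w^T M : 'M_(1 + n)).

Let bdet1 n (M : 'M[R]_n) v w : bdet M 1 v w = \det (M + w^T *m v).
Proof.
have -> : bdet M 1 v w =
    \det ((block_mx 1%:M 0 w^T 1%:M : 'M_(1 + n))
            *m block_mx 1%:M (- v) 0 (M + w^T *m v)).
  rewrite mulmx_block !mul1mx !mul0mx !mulmx1 !addr0 mulmxN.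
  by rewrite [- _ + _]addrC addrK.
by rewrite det_mulmx det_lblock det_ublock !det1 !mul1r.
Qed.

Let bdetl n (M : 'M[R]_n) a b x y v v' w :
  bdet M (x * a + y * b) (x *: v + y *: v') w = x * bdet M a v w + y * bdet M b v' w.
Proof.
apply: (determinant_multilinear (i0 := lshift n (0 : 'I_1))).
- apply/rowP=> j; rewrite -[j]splitK; case: (split j) => k /=; rewrite !mxE.
    by rewrite !(unsplitK (inl _)) !mxE !(unsplitK (inl _)) !mxE !ord1 ?eqxx ?mulr1n.
  by rewrite (unsplitK (inl _)) !mxE (unsplitK (inr _)) !mxE; ring.
- apply/matrixP=> i j; rewrite !mxE.
  have -> : lift (lshift n (0 : 'I_1)) i = rshift 1 i by exact/val_inj.
  by rewrite (unsplitK (inr _)).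
- apply/matrixP=> i j; rewrite !mxE.
  have -> : lift (lshift n (0 : 'I_1)) i = rshift 1 i by exact/val_inj.
  by rewrite (unsplitK (inr _)).
Qed.

Let bdet_tr n (M : 'M[R]_n) v w : bdet M 0 v w = bdet M^T 0 (- w) (- v).
Proof.
rewrite /bdet -det_tr tr_block_mx trmxK opprK.
by rewrite !raddfN /= !raddf0.
Qed.

Lemma linear_row_expand n (f : 'rV[R]_n -> R) :
  (forall x y u v, f (x *: u + y *: v) = x * f u + y * f v) ->
  forall v, f v = \sum_j v 0 j * f (delta_mx 0 j).
Proof.
move=> flin v; rewrite {1}[v]row_sum_delta.
have f0 : f 0 = 0 by have := flin 0 0 0 0; rewrite !scale0r addr0 !mul0r addr0.
have fZ x u : f (x *: u) = x * f u.
  by have := flin x 0 u 0; rewrite scale0r addr0 mul0r addr0.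
have fD u w : f (u + w) = f u + f w.
  by have := flin 1 1 u w; rewrite !scale1r !mul1r.
elim/big_rec2: _ => // j y1 y2 _ <-; by rewrite fD fZ.
Qed.

Let bdet_form n (M : 'M[R]_n) :
  exists Q : 'M[R]_n, forall v w, bdet M 0 v w = (v *m Q *m w^T) 0 0.
Proof.
pose Q := \matrix_(j, i) bdet M 0 (delta_mx 0 j) (delta_mx 0 i) : 'M[R]_n.
exists Q => v w.
have lv w0 : bdet M 0 v w0 = \sum_j v 0 j * bdet M 0 (delta_mx 0 j) w0.
  apply: (@linear_row_expand _ (fun v => bdet M 0 v w0)) => x y u u'.
  by rewrite -bdetl !mulr0 addr0.
have lw v0 : bdet M 0 v0 w = \sum_i w 0 i * bdet M 0 v0 (delta_mx 0 i).
  apply: (@linear_row_expand _ (fun w => bdet M 0 v0 w)) => x y u u'.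
  by rewrite bdet_tr opprD -!scalerN [in RHS]bdet_tr [in X in _ + _ * X]bdet_tr -bdetl !mulr0 addr0.
rewrite lv mxE.
under eq_bigr => j _ do rewrite lw mulr_sumr.
rewrite exchange_big /=; apply: eq_bigr => i _; rewrite !mxE mulr_suml.
by apply: eq_bigr => j _; rewrite !mxE; ring.
Qed.

(** The border row splits as (1, 0) plus [z] times (0, [- v]). That one matrix [Q] serves all [v] is
    what allows averaging over signs. *)
Lemma det_rank1 n (M : 'M[R]_n) : exists Q : 'M[R]_n, forall z v,
  \det (M + z *: rank1 v) = \det M + z * (v *m Q *m v^T) 0 0.
Proof.
have [Q bQ] := bdet_form M; exists Q => z v.
rewrite /rank1 scalemxAr -bdet1 -bQ.
have -> : bdet M 1 (z *: v) v = 1 * bdet M 1 0 v + z * bdet M 0 v v.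
  by rewrite -bdetl !mulr0 mulr1 addr0 scaler0 add0r.
by rewrite bdet1 mulmx0 addr0 mul1r.
Qed.

Lemma mixed_det_rank1 n (L : seq (seq 'rV[R]_n)) M :
  exists Q : 'M[R]_n, forall z v,
    mixed_det L (M + z *: rank1 v) = mixed_det L M + z * (v *m Q *m v^T) 0 0.
Proof.
elim: L M => [|V L IH] M /=; first exact: det_rank1.
elim: V => [|u V [Q HQ]].
  by exists 0 => z v; rewrite !big_nil mulmx0 mul0mx mxE mulr0 addr0.
have [Q' HQ'] := IH (M + rank1 u).
exists (Q' + Q) => z v; rewrite !big_cons HQ addrAC HQ' mulmxDr mulmxDl.
by rewrite [in RHS]mxE; ring.
Qed.

End RankOne.

Lemma map_rank1 (R S : comNzRingType) (f : {rmorphism R -> S}) n (v : 'rV[R]_n) :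
  map_mx f (rank1 v) = rank1 (map_mx f v).
Proof. by rewrite map_mxM -map_trmx. Qed.

Lemma map_mixed_det (R S : comNzRingType) (f : {rmorphism R -> S}) n
    (L : seq (seq 'rV[R]_n)) M :
  f (mixed_det L M) = mixed_det (map (map (map_mx f)) L) (map_mx f M).
Proof.
elim: L M => [|V L IH] M /=; first by rewrite det_map_mx.
rewrite rmorph_sum big_map; apply: eq_bigr => v _.
by rewrite IH map_mxD map_rank1.
Qed.

(** * Zero-freeness of mixed determinants *)

Section Stability.
Variable C : numClosedFieldType.

Definition real_row n (v : 'rV[C]_n) := map_mx Num.conj v = v.

Definition dissipative n (M : 'M[C]_n) : Prop :=
  forall w : 'rV[C]_n, w != 0 -> 0 < 'Im ((w *m M *m (map_mx Num.conj w)^T) 0 0).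

Lemma det_dissipative n (M : 'M[C]_n) : dissipative M -> \det M != 0.
Proof.
move=> dM; apply/det0P => -[w w0 wM0]; have := dM w w0.
by rewrite wM0 mul0mx mxE raddf0 ltxx.
Qed.

Lemma dissipativeD n (M : 'M[C]_n) z v : dissipative M -> real_row v -> 0 <= 'Im z ->
  dissipative (M + z *: rank1 v).
Proof.
move=> dM rv z0 w w0; rewrite mulmxDr mulmxDl mxE raddfD /=.
apply: ltr_wpDr (dM _ w0).
rewrite /rank1 -scalemxAr -scalemxAl mxE (mulmxA w) -(mulmxA (w *m v^T)) mxE big_ord1.
have -> : (v *m (map_mx Num.conj w)^T) 0 0 = ((w *m v^T) 0 0)^*.
  rewrite -[in LHS]rv !mxE rmorph_sum; apply: eq_bigr => i _.
  by rewrite !mxE rmorphM mulrC.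
rewrite -normCK ImMr; last by rewrite rpredX ?normr_real.
by rewrite mulr_ge0 // exprn_ge0.
Qed.

Lemma dissipative_scalar_sym n (M : 'M[C]_n) x : 0 < 'Im x ->
  M^T = M -> map_mx Num.conj M = M -> dissipative (x%:M + M).
Proof.
move=> x0 sM rM w w0; rewrite mulmxDr mulmxDl mxE raddfD /=.
have -> : 'Im ((w *m M *m (map_mx Num.conj w)^T) 0 0) = 0.
  apply/Creal_ImP/CrealP.
  have -> (A : 'M[C]_1) : (A 0 0)^* = (map_mx Num.conj A)^T 0 0 by rewrite !mxE.
  rewrite !map_mxM -map_trmx !trmx_mul trmxK rM sM mulmxA.
  have e : map_mx Num.conj (map_mx Num.conj w) = w.
    by apply/matrixP=> i j; rewrite !mxE conjCK.
  by rewrite [X in X *m _ *m _]e.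
rewrite addr0 mul_mx_scalar -scalemxAl mxE ImMr; last first.
  apply/CrealP; rewrite mxE rmorph_sum; apply: eq_bigr => i _.
  by rewrite !mxE rmorphM /= conjCK mulrC.
apply: mulr_gt0 => //.
rewrite mxE; under eq_bigr => i _ do rewrite !mxE -normCK.
have [i wi] : exists i, w 0 i != 0.
  apply/existsP; apply: contraR w0; rewrite negb_exists => /forallP h.
  by apply/eqP/rowP=> j; rewrite mxE; have := h j; rewrite negbK => /eqP.
rewrite (bigD1 i) //=; apply: ltr_wpDr.
  by apply: sumr_ge0 => j _; rewrite exprn_ge0.
by rewrite exprn_gt0 // normr_gt0.
Qed.

Definition real_vectors n (L : seq (seq 'rV[C]_n)) :=
  forall V, V \in L -> V != [::] /\ forall v, v \in V -> real_row v.

Lemma affine_half_plane (a b : C) :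
  (forall z, 0 <= 'Im z -> a + z * b != 0) -> b = 0 \/ 'Im (b * a^*) < 0.
Proof.
move=> h; have [->|b0] := eqVneq b 0; [by left | right].
rewrite real_ltNge ?Creal_Im ?real0 //; apply/negP => ge0.
have /h : 0 <= 'Im (- (a / b)); last by rewrite mulNr divfK // subrr eqxx.
have -> : - (a / b) = `|b| ^- 2 * - (b * a^*)^*.
  by rewrite invC_norm rmorphM /= conjCK; ring.
rewrite ImMl; last by rewrite rpredV rpredX ?normr_real.
by rewrite raddfN /= Im_conj opprK mulr_ge0 // invr_ge0 exprn_ge0.
Qed.

(** Induction on [L]: zero-freeness for [L] at all updates with [z] in the closed upper half-plane
    controls each increment through [affine_half_plane], and the increments over [V] cannot cancel
    the main term. *)
Lemma mixed_det_half_plane n (L : seq (seq 'rV[C]_n)) :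
  real_vectors L -> forall M, dissipative M ->
  mixed_det L M != 0 /\
  forall v, real_row v -> let b := mixed_det L (M + rank1 v) - mixed_det L M in
    b = 0 \/ 'Im (b * (mixed_det L M)^*) < 0.
Proof.
move=> rL; suff nz M : dissipative M -> mixed_det L M != 0.
  move=> M dM; split; first exact: nz.
  move=> v rv b; apply: affine_half_plane => z z0.
  have [Q HQ] := mixed_det_rank1 L M.
  have -> : mixed_det L M + z * b = mixed_det L (M + z *: rank1 v).
    by rewrite /b -[X in M + X]scale1r !HQ; ring.
  by apply: nz; apply: dissipativeD.
elim: L rL M => [|V L IH] rL M dM /=; first exact: det_dissipative.
have rL' : real_vectors L by move=> W WL; apply: rL; rewrite inE WL orbT.
have [V0 rV] := rL V (mem_head _ _).
have {}IH := IH rL'.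
set a := mixed_det L M; have a0 : a != 0 by exact: IH.
pose b v := mixed_det L (M + rank1 v) - a.
have hb v : v \in V -> b v = 0 \/ 'Im (b v * a^*) < 0.
  move=> vV; apply: affine_half_plane => z z0.
  have [Q HQ] := mixed_det_rank1 L M.
  have -> : a + z * b v = mixed_det L (M + z *: rank1 v).
    by rewrite /b /a -[X in M + X]scale1r !HQ; ring.
  by apply: IH; apply: dissipativeD => //; apply: rV.
have -> : \sum_(v <- V) mixed_det L (M + rank1 v) = (size V)%:R * a + \sum_(v <- V) b v.
  rewrite /b sumrB big_const_seq count_predT iter_addr_0 mulr_natl.
  by rewrite [RHS]addrC subrK.
have [b0|] := boolP (all (fun v => b v == 0) V).
  rewrite big_seq big1 => [|v vV]; last by apply/eqP; exact: (allP b0).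
  by rewrite addr0 mulf_neq0 // pnatr_eq0 size_eq0.
(* Some increment is nonzero, so after multiplication by [a^*] the sum has negative imaginary part,
   the main term having become real. *)
case/allPn => u uV bu0; apply/eqP => e0.
have : 'Im (((size V)%:R * a + \sum_(v <- V) b v) * a^*) = 0.
  by rewrite e0 mul0r raddf0.
rewrite mulrDl raddfD /= -mulrA ImMl ?rpred_nat // -normCK.
rewrite (Creal_ImP _ _) ?rpredX ?normr_real // mulr0 add0r mulr_suml raddf_sum /=.
rewrite (perm_big _ (perm_to_rem uV)) big_cons => /eqP; apply/negP; rewrite lt_eqF //.
apply: ltr_wnDr.
  rewrite big_seq; apply: sumr_le0 => v /mem_rem vV.
  by case: (hb v vV) => [->|/ltW//]; rewrite mul0r raddf0.
by case: (hb u uV) => // e; rewrite e eqxx in bu0.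
Qed.

End Stability.

(** * Real polynomials on the upper half-plane *)

Section HalfPlane.
Variable R : rcfType.
Local Notation C := R[i].
Local Notation rc := (real_complex R).

Definition ceval (z : C) (p : {poly R}) : C := (map_poly rc p).[z].

HB.instance Definition _ z := GRing.RMorphism.copy (ceval z) (horner_eval z \o map_poly rc).

Lemma real_complex_real (x : R) : rc x \is Num.real.
Proof. by rewrite complex_real. Qed.

Lemma real_complex_conj (x : R) : (rc x)^* = rc x.
Proof. exact/CrealP/real_complex_real. Qed.

Lemma ceval_conj z p : (ceval z p)^* = ceval z^* p.
Proof.
rewrite /ceval -horner_map /= -map_poly_comp; congr (_ .[_]).
by apply: eq_map_poly => x /=; exact: real_complex_conj.
Qed.

Lemma ceval_real x p : ceval (rc x) p = rc p.[x].
Proof. by rewrite /ceval horner_map. Qed.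

Lemma cevalXsubC z x : ceval z ('X - x%:P) = z - rc x.
Proof. by rewrite /ceval rmorphB /= map_polyX map_polyC hornerXsubC. Qed.

Lemma Im0_real_complex (z : C) : 'Im z = 0 -> exists x, z = rc x.
Proof.
move=> z0; exists (complex.Re z); rewrite complexRe.
by rewrite [LHS]Crect z0 mulr0 addr0.
Qed.

(** Roots of a real polynomial come in conjugate pairs, so none lies in the lower half-plane
    either. *)
Lemma no_half_plane_root_split (p : {poly R}) :
  (forall z, 0 < 'Im z -> ceval z p != 0) ->
  exists s, p = lead_coef p *: \prod_(x <- s) ('X - x%:P).
Proof.
move=> h.
have [r Hr] := closed_field_poly_normal (map_poly rc p).
have p0 : p != 0.
  by apply: contraNneq (h 'i _) => [->|]; rewrite ?rmorph0 // Im_i ltr01.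
have rr z : z \in r -> exists x, z = rc x.
  move=> zr; apply: Im0_real_complex; apply/eqP.
  have ez : ceval z p = 0.
    apply/eqP; rewrite /ceval Hr hornerZ mulf_eq0; apply/orP; right.
    by rewrite -[_ == 0]/(root _ _) root_prod_XsubC.
  case: (real_ltgt0P (Creal_Im z)) => // lz.
    by have := h z lz; rewrite ez eqxx.
  have := h z^*; rewrite Im_conj oppr_gt0 => /(_ lz).
  by rewrite -ceval_conj ez rmorph0 eqxx.
have [s es] : exists s, r = map rc s.
  elim: r rr {Hr} => [|z r IH] rr; first by exists [::].
  have [x ->] := rr z (mem_head _ _).
  have [s ->] : exists s, r = map rc s.
    by apply: IH => w wr; apply: rr; rewrite inE wr orbT.
  by exists (x :: s).
exists s; apply: (map_poly_inj rc).
rewrite Hr es map_polyZ /= lead_coef_map; congr (_ *: _).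
rewrite rmorph_prod big_map; apply: eq_bigr => x _.
by rewrite rmorphB /= map_polyX map_polyC.
Qed.

(** The m-th roots of [k] sum to zero and none is real because [k] is not, so they cannot all lie in
    the lower half-plane. *)
Lemma half_plane_root (m : nat) (k : C) : (1 < m)%N -> 'Im k != 0 ->
  exists2 w, 0 < 'Im w & w ^+ m = k.
Proof.
move=> m1 k0; have m0 : (0 < m)%N by exact: ltnW.
have [r Hr] := closed_field_poly_normal ('X^m - k%:P).
rewrite (lead_coefXnsubC _ m0) scale1r in Hr.
have sr : size r = m.
  by have := size_XnsubC k m0; rewrite Hr size_prod_XsubC => -[].
have rootr w : w \in r -> w ^+ m = k.
  rewrite -root_prod_XsubC -Hr /root !hornerE subr_eq0.
  by move/eqP.
have s0 : \sum_(w <- r) w = 0.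
  apply: oppr_inj; rewrite -coefPn_prod_XsubC ?sr -?lt0n // -Hr.
  rewrite coefB coefXn coefC oppr0 -subn1 eq_sym.
  have -> : (m - 1 == 0)%N = false by apply/eqP; lia.
  have -> : (m == m - 1)%N = false by apply/eqP; lia.
  by rewrite subr0.
have [/hasP[w wr w0]|/hasPn nr] := boolP (has (fun w : C => 0 < 'Im w) r).
  by exists w => //; exact: rootr.
have neg w : w \in r -> 'Im w < 0.
  move=> wr; have := nr w wr.
  rewrite -real_leNgt ?Creal_Im ?real0 // le_eqVlt => /orP[/eqP w0|//].
  have /Creal_ImP wR : w \is Num.real by apply/Creal_ImP.
  move: k0; rewrite -(rootr w wr); have /Creal_ImP -> : w ^+ m \is Num.real.
    by rewrite rpredX //; apply/Creal_ImP.
  by rewrite eqxx.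
have : 'Im (\sum_(w <- r) w) = 0 by rewrite s0 raddf0.
case: r sr neg {Hr rootr s0 nr} => [|w r] sr neg.
  by move: m0; rewrite -sr.
rewrite big_cons raddfD raddf_sum /= => /eqP; rewrite lt_eqF //.
apply: ltr_wnDr; last by apply: neg; exact: mem_head.
rewrite big_seq; apply: sumr_le0 => u ur; apply/ltW/neg.
by rewrite inE ur orbT.
Qed.

(** On the real line ['Im G] is a real polynomial, so the inequality passes to the limit at 0. *)
Lemma Im_poly_le0 (G : {poly C}) :
  (forall e : R, 0 < e -> 'Im G.[rc e] <= 0) -> 'Im G.[0] <= 0.
Proof.
have [p [q GE]] : exists p q : {poly R},
    forall e, G.[rc e] = rc p.[e] + 'i * rc q.[e].
  elim/poly_ind: G => [|G c [p [q IH]]].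
    by exists 0, 0 => e; rewrite !horner0 !rmorph0 mulr0 addr0.
  exists (p * 'X + (complex.Re c)%:P), (q * 'X + (complex.Im c)%:P) => e.
  rewrite !hornerMXaddC IH !rmorphD !rmorphM /= complexRe complexIm.
  by rewrite {1}[c]Crect; ring.
have ImG e : 'Im G.[rc e] = rc q.[e].
  by rewrite GE Im_rect ?real_complex_real.
rewrite -(rmorph0 rc) ImG => h; rewrite lecR leNgt; apply/negP => q0.
have [d d0 hd] := poly_cont 0 q q0.
have h2 : 0 < d / 2 by rewrite divr_gt0.
have := hd (d / 2); rewrite subr0 gtr0_norm // ltr_pdivrMr // ltr_pMr // ltr1n.
move=> /(_ isT); rewrite ltr_norml => /andP[lo _].
have := h _ h2; rewrite ImG lecR; lra.
Qed.

Implicit Type s : seq R.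

Definition rootprod s : {poly R} := \prod_(x <- s) ('X - x%:P).

(* At a real root of [rootprod s] of multiplicity m the quotient b / rootprod s
   behaves like c (z - x)^(-m), whose imaginary part takes both signs on the
   upper half-plane unless m = 1. *)
Lemma half_plane_simple_root s (b : {poly R}) x :
  (forall z, 0 < 'Im z -> 'Im (ceval z b * (ceval z (rootprod s))^*) <= 0) ->
  x \in s -> b.[x] != 0 ->
  x \notin rem x s /\ 0 < b.[x] * (rootprod (rem x s)).[x].
Proof.
move=> hb xs bx0.
pose m := count_mem x s; pose s' := filter (predC1 x) s.
have sE : perm_eq s (nseq m x ++ s').
  rewrite /m -size_filter -(all_pred1P _ _ (filter_all _ _)) perm_sym.
  by rewrite perm_filterC.
have aE : rootprod s = ('X - x%:P) ^+ m * rootprod s'.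
  rewrite /rootprod (perm_big _ sE) big_cat /=; congr (_ * _).
  by rewrite big_nseq -Monoid.iteropE.
have m0 : (0 < m)%N by rewrite -has_count has_pred1.
pose K := b.[x] * (rootprod s').[x].
have K0 : K != 0.
  rewrite mulf_neq0 // -[_ == 0]/(root _ _) root_prod_XsubC.
  by rewrite mem_filter /= eqxx.
(* The hypothesis at z = x + e w, divided by e^m, tends to this as e decreases to 0. *)
have key w : 0 < 'Im w -> 'Im (w^* ^+ m * rc K) <= 0.
  move=> w0.
  pose G : {poly C} := (w^* ^+ m)%:P *
    ((map_poly rc b \Po ((rc x)%:P + w *: 'X)) *
     (map_poly rc (rootprod s') \Po ((rc x)%:P + w^* *: 'X))).
  have GE e : G.[e] = w^* ^+ m * (ceval (rc x + w * e) b * ceval (rc x + w^* * e) (rootprod s')).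
    by rewrite /G !hornerM !horner_comp !hornerE.
  have -> : w^* ^+ m * rc K = G.[0].
    by rewrite GE !mulr0 !addr0 !ceval_real rmorphM.
  apply: Im_poly_le0 => e e0.
  have Ie : 0 < 'Im (rc x + w * rc e).
    rewrite raddfD /= (Creal_ImP _ (real_complex_real x)) add0r.
    by rewrite ImMr ?real_complex_real // mulr_gt0 // ltcR.
  have := hb _ Ie; rewrite aE [ceval _ (_ * _)]rmorphM rmorphXn /= cevalXsubC.
  rewrite addrAC subrr add0r rmorphM rmorphXn /= rmorphM /= real_complex_conj.
  rewrite ceval_conj rmorphD rmorphM /= !real_complex_conj.
  set B := ceval _ b; set A := ceval _ _ => h.
  have : 'Im (rc (e ^+ m) * G.[rc e]) <= 0.
    by rewrite GE rmorphXn /=; move: h; congr ('Im _ <= 0); rewrite exprMn; ring.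
  by rewrite ImMl ?real_complex_real // pmulr_rle0 // ltcR exprn_gt0.
have m1 : m = 1%N.
  apply/eqP; rewrite eqn_leq m0 andbT leqNgt; apply/negP => m2.
  (* For m at least 2 take w with w^m = -iK: the left-hand side of [key] is then the imaginary part
     of iK^2, which is positive. *)
  have IK : 'Im (- ('i * rc K) : C) = - rc K.
    by rewrite raddfN /= ImMil; congr -%R; apply/Creal_ReP/real_complex_real.
  have [|w w0 wm] := @half_plane_root m (- ('i * rc K)) m2.
    by rewrite IK oppr_eq0 fmorph_eq0.
  have := key w w0; rewrite -rmorphXn /= wm rmorphN rmorphM /= conjCi.
  rewrite real_complex_conj !mulNr opprK -mulrA ImMil -rmorphM /=.
  rewrite (Creal_ReP _ (real_complex_real _)) lecR leNgt.
  by rewrite -expr2 exprn_even_gt0 //= K0.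
have rE : perm_eq (rem x s) s'.
  rewrite -(perm_cons x) perm_sym; apply: perm_trans (perm_to_rem xs).
  by rewrite perm_sym; move: sE; rewrite m1.
split; first by rewrite (perm_mem rE) mem_filter /= eqxx.
rewrite /rootprod (perm_big _ rE) lt_def K0 /=.
have := key 'i; rewrite Im_i ltr01 => /(_ isT).
rewrite m1 expr1 conjCi mulNr raddfN /= ImMil.
by rewrite (Creal_ReP _ (real_complex_real _)) oppr_le0 ler0c.
Qed.

(* [partial_frac cs] is [rootprod (unzip1 cs) * \sum_(p <- cs) p.2 / ('X - p.1)]. *)
Fixpoint partial_frac (cs : seq (R * R)) : {poly R} :=
  if cs is p :: cs' then
    p.2 *: rootprod (unzip1 cs') + ('X - p.1%:P) * partial_frac cs'
  else 0.

Lemma rootprod_cons x s : rootprod (x :: s) = ('X - x%:P) * rootprod s.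
Proof. exact: big_cons. Qed.

Lemma perm_rootprod s t : perm_eq s t -> rootprod s = rootprod t.
Proof. exact: perm_big. Qed.

Lemma rootprod_cat s t : rootprod (s ++ t) = rootprod s * rootprod t.
Proof. exact: big_cat. Qed.

Lemma partial_frac_cat cs ds : partial_frac (cs ++ ds) =
  partial_frac cs * rootprod (unzip1 ds) + rootprod (unzip1 cs) * partial_frac ds.
Proof.
elim: cs => [|p cs IH] /=; first by rewrite mul0r add0r /rootprod big_nil mul1r.
rewrite IH /unzip1 map_cat rootprod_cat rootprod_cons -!mul_polyC; ring.
Qed.

Lemma perm_partial_frac cs ds : perm_eq cs ds -> partial_frac cs = partial_frac ds.
Proof.
move=> h; suff : partial_frac cs == partial_frac ds by move/eqP.
apply: (catCA_perm_ind (P := fun es => partial_frac cs == partial_frac es)) h _ => //.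
move=> s1 s2 s3 /eqP ->; apply/eqP; rewrite !partial_frac_cat /unzip1 !map_cat !rootprod_cat; ring.
Qed.

Lemma size_partial_frac cs : (size (partial_frac cs) <= size cs)%N.
Proof.
elim: cs => [|p cs IH] /=; first by rewrite size_poly0.
apply: leq_trans (size_polyD _ _) _; rewrite geq_max; apply/andP; split.
  by apply: leq_trans (size_scale_leq _ _) _; rewrite size_prod_XsubC size_map.
apply: leq_trans (size_polyMleq _ _) _; rewrite size_XsubC; exact: IH.
Qed.

(** Common roots of [b] and [rootprod s] are divided out first. Once none is left, all roots in [s]
    are simple with positive residues, and Lagrange interpolation recovers [b]. *)
Lemma half_plane_partial_frac s (b : {poly R}) :
  (size b <= size s)%N ->
  (forall z, 0 < 'Im z -> 'Im (ceval z b * (ceval z (rootprod s))^*) <= 0) ->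
  exists cs, [/\ perm_eq (unzip1 cs) s, all (fun p => 0 <= p.2) cs & b = partial_frac cs].
Proof.
have [n] := ubnP (size s); elim: n s b => // n IH s b sn sb hb.
have [/hasP[x xs bx]|/hasPn nb] := boolP (has (root b) s).
  have /factor_theorem[b' eb] := bx.
  have ps := perm_to_rem xs.
  have ss : size s = (size (rem x s)).+1 by rewrite (perm_size ps).
  have [|||cs [pcs cs0 ecs]] := IH (rem x s) b'.
  - by rewrite ss in sn.
  - have [->|b'0] := eqVneq b' 0; first by rewrite size_poly0.
    by move: sb; rewrite eb size_Mmonic ?monicXsubC // size_XsubC addn2 ss.
  - move=> z z0; have := hb z z0.
    rewrite eb (perm_rootprod ps) rootprod_cons !rmorphM /= cevalXsubC.
    set A := ceval z _; set B := (ceval z _)^*; set u := z - _.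
    (* The common factor contributes only |u|^2, so the half-plane condition survives the
       division. *)
    have -> : A * u * (u^* * B) = `|u| ^+ 2 * (A * B) by rewrite normCK; ring.
    rewrite ImMl ?rpredX ?normr_real // pmulr_rle0 // exprn_gt0 // normr_gt0.
    apply: contraTneq z0 => u0; move/eqP: u0; rewrite subr_eq0 => /eqP ->.
    by rewrite (Creal_ImP _ (real_complex_real _)) ltxx.
  (* A cancelled root stays in the list as a pole with residue 0. *)
  exists ((x, 0) :: cs); split => /=.
  - by apply: perm_trans (_ : perm_eq (x :: rem x s) s); rewrite ?perm_cons // perm_sym.
  - by rewrite lexx.
  - by rewrite scale0r add0r -ecs eb mulrC.
have key x : x \in s -> x \notin rem x s /\ 0 < b.[x] * (rootprod (rem x s)).[x].
  by move=> xs; apply: half_plane_simple_root => //; exact: nb.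
have us : uniq s.
  apply: count_mem_uniq => x; have [xs|xs] := boolP (x \in s); last first.
    by apply/count_memPn.
  have [/count_memPn cx _] := key x xs.
  by rewrite (seq.permP (perm_to_rem xs)) /= eqxx cx.
pose c x := b.[x] / (rootprod (rem x s)).[x].
pose cs := [seq (x, c x) | x <- s].
have ucs : unzip1 cs = s by rewrite /cs /unzip1 -map_comp map_id.
exists cs; split; first by rewrite ucs.
  apply/allP => _ /mapP[x xs ->] /=; have [_ h] := key x xs.
  have P0 : (rootprod (rem x s)).[x] != 0 by apply: contraTneq h => ->; rewrite mulr0 ltxx.
  have -> : c x = b.[x] * (rootprod (rem x s)).[x] / (rootprod (rem x s)).[x] ^+ 2.
    by rewrite /c expr2 invfM mulrA mulfK.
  by rewrite divr_ge0 ?sqr_ge0 // ltW.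
apply/eqP; rewrite -subr_eq0; apply/eqP.
(* Both sides have size at most [size s] and agree at the [size s] distinct points of [s]. *)
apply: (@roots_geq_poly_eq0 _ _ s) => //.
  apply/allP => x xs; rewrite /root hornerD hornerN subr_eq0; apply/eqP.
  have pcs : perm_eq cs ((x, c x) :: [seq (y, c y) | y <- rem x s]).
    by rewrite -map_cons perm_map // perm_to_rem.
  rewrite (perm_partial_frac pcs) /= hornerD hornerZ hornerM hornerXsubC subrr mul0r addr0.
  rewrite /unzip1 -map_comp map_id /c divfK //.
  by have [_] := key x xs; apply: contraTneq => ->; rewrite mulr0 ltxx.
apply: leq_trans (size_polyD _ _) _; rewrite geq_max sb size_polyN /=.
by apply: leq_trans (size_partial_frac _) _; rewrite size_map.
Qed.

End HalfPlane.

(** * Interlacing and selection *)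

Lemma perm_map_lift (T S : eqType) (f : T -> S) (u : seq T) (s : seq S) :
  perm_eq (map f u) s -> exists v, perm_eq u v /\ map f v = s.
Proof.
elim: s u => [|x s IH] u h.
  by exists [::]; move: (perm_size h); rewrite size_map => /size0nil ->.
have /mapP[y yu xE] : x \in map f u by rewrite (perm_mem h) mem_head.
have pu := perm_to_rem yu.
have [|v [pv ev]] := IH (rem y u).
  by rewrite -(perm_cons x) {1}xE -map_cons -(permPl (perm_map f pu)).
exists (y :: v); rewrite /= -xE ev; split => //.
by rewrite (permPl pu) perm_cons.
Qed.

Section Selection.
Variable R : rcfType.
Implicit Types (s : seq R) (cs : seq (R * R)).

Definition pos_above (rho : R) (p : {poly R}) := forall x, rho < x -> 0 < p.[x].

Lemma rootprod_gt0 s x : (forall y, y \in s -> y < x) -> 0 < (rootprod s).[x].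
Proof.
move=> h; rewrite /rootprod horner_prod big_seq; apply: prodr_gt0 => y ys.
by rewrite hornerXsubC subr_gt0 h.
Qed.

Lemma rootprod_ge0 s x : (forall y, y \in s -> y <= x) -> 0 <= (rootprod s).[x].
Proof.
move=> h; rewrite /rootprod horner_prod big_seq; apply: prodr_ge0 => y ys.
by rewrite hornerXsubC subr_ge0 h.
Qed.

Lemma partial_frac_horner cs x : x \notin unzip1 cs ->
  (partial_frac cs).[x] = (rootprod (unzip1 cs)).[x] * \sum_(p <- cs) p.2 / (x - p.1).
Proof.
elim: cs => [|p cs IH] /=; first by rewrite horner0 big_nil mulr0.
rewrite inE negb_or => /andP[xp xcs].
rewrite big_cons rootprod_cons !hornerE IH //.
have x0 : x - p.1 != 0 by rewrite subr_eq0.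
by field.
Qed.

(** Above the points of [unzip1 cs], f is a positive product times (t - x1)(1 + h t) + c1 with h
    nonnegative and nonincreasing. A nonpositive value at [x] forces x <= x1, and going down from
    there both t - x1 and 1 + h t grow in modulus. *)
Lemma partial_frac_le0_down (x1 c1 : R) cs (x y : R) : 0 <= c1 -> all (fun p => 0 <= p.2) cs ->
  y <= x -> (forall z, z \in unzip1 cs -> z < y) ->
  let f := rootprod (x1 :: unzip1 cs) + partial_frac ((x1, c1) :: cs) in
  f.[x] <= 0 -> f.[y] <= 0.
Proof.
move=> c10 cs0 yx ycs f.
have xcs z : z \in unzip1 cs -> z < x by move=> /ycs zy; exact: lt_le_trans yx.
pose h t := \sum_(p <- cs) p.2 / (t - p.1).
have fE t : (forall z, z \in unzip1 cs -> z < t) ->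
    f.[t] = (rootprod (unzip1 cs)).[t] * ((t - x1) * (1 + h t) + c1).
  move=> tcs; rewrite /f rootprod_cons /= !hornerE partial_frac_horner.
    by rewrite /h /=; ring.
  by apply/negP => /tcs; rewrite ltxx.
rewrite !fE // !pmulr_rle0 ?rootprod_gt0 //.
have hx0 : 0 <= h x.
  rewrite /h big_seq; apply: sumr_ge0 => p pcs; rewrite divr_ge0 ?(allP cs0) //.
  by rewrite subr_ge0 ltW // xcs // map_f.
have hxy : h x <= h y.
  rewrite /h !big_seq; apply: ler_sum => p pcs; rewrite ler_wpM2l ?(allP cs0) //.
  rewrite lef_pV2 ?posrE ?subr_gt0 ?ycs ?xcs ?map_f //; lra.
move=> fx; have x1x : x - x1 <= 0 by nra.
nra.
Qed.

(** At the second largest point of [s] all [f v] are nonpositive, so [rho] is at least that point.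
    If each [f v] were nonpositive somewhere above [rho], it would remain so down to the smallest of
    these places, where the sum would then be nonpositive. *)
Lemma interlacing_select (I : eqType) (V : seq I) (f : I -> {poly R}) s c rho :
  0 < c -> V != [::] ->
  (forall v, v \in V -> exists cs, [/\ perm_eq (unzip1 cs) s,
     all (fun p => 0 <= p.2) cs & f v = c *: (rootprod s + partial_frac cs)]) ->
  pos_above rho (\sum_(v <- V) f v) ->
  exists2 v, v \in V & pos_above rho (f v).
Proof.
move=> c0 V0 fV pos.
have [s' [ss ps]] : exists s', sorted >=%R s' /\ perm_eq s s'.
  exists (sort >=%R s); split; first by apply: sort_sorted; exact: ge_total.
  by rewrite perm_sym perm_sort.
have {}fV v : v \in V -> exists cs, [/\ unzip1 cs = s',
     all (fun p => 0 <= p.2) cs & f v = c *: (rootprod s' + partial_frac cs)].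
  move=> /fV[cs [p1 p2 p3]].
  have {p1} p1 := perm_trans p1 ps.
  have [ds [pd ed]] : exists ds, perm_eq cs ds /\ unzip1 ds = s'.
    exact: perm_map_lift.
  exists ds; split => //; first by rewrite -(perm_all _ pd).
  by rewrite p3 (perm_rootprod ps) (perm_partial_frac pd).
case: s' ss {ps} fV => [|x1 s'] ss fV.
  case: V V0 fV pos => // v V _ fV _.
  exists v; first exact: mem_head.
  have [cs [e _ ->]] := fV v (mem_head _ _).
  case: cs e => // _ x _ /=.
  by rewrite addr0 hornerZ /rootprod big_nil hornerC mulr1.
have rho_ge z : z \in s' -> z <= rho.
  case: s' ss fV => [//|x2 s''] /= /andP[x21 ss] fV.
  have x2s y : y \in s'' -> y <= x2.
    move: ss; rewrite (path_sortedE ge_trans) => /andP[/allP h _]; exact: h.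
  move=> zs; apply: (@le_trans _ _ x2).
    by move: zs; rewrite inE => /orP[/eqP->//|/x2s].
  (* At [x2] only the residue term of that pole survives, and its factor x2 - x1 is nonpositive. *)
  rewrite leNgt; apply/negP => /pos; apply/negP; rewrite -leNgt horner_sum big_seq.
  apply: sumr_le0 => v /fV[cs [ecs cs0 ->]].
  case: cs ecs cs0 => // p1 [//|p2 cs] [e1 e2 e3] /and3P[p10 p20 _].
  rewrite hornerZ pmulr_rle0 //= !rootprod_cons e1 e2 e3 !hornerE subrr.
  rewrite /= !(mul0r, mulr0, addr0, add0r).
  apply: mulr_le0_ge0; first by rewrite subr_le0.
  by rewrite mulr_ge0 // rootprod_ge0.
apply: contrapT => nex.
have bad v : v \in V -> exists2 x, rho < x & (f v).[x] <= 0.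
  move=> vV; apply: contrapT => nx; apply: nex; exists v => // x rx.
  by rewrite ltNge; apply/negP => fx; apply: nx; exists x.
have [x rx fx] : exists2 x, rho < x & forall v, v \in V -> (f v).[x] <= 0.
  elim: V {V0 pos nex} fV bad => [|v V IH] fV bad; first by exists (rho + 1) => //; rewrite ltrDl.
  have [x rx fx] : exists2 x, rho < x & forall v, v \in V -> (f v).[x] <= 0.
    by apply: IH => u uV; [apply: fV|apply: bad]; rewrite inE uV orbT.
  have [y ry fy] := bad v (mem_head _ _).
  (* The minimum exceeds [rho], hence every pole but the largest, so nonpositivity descends to
     it. *)
  exists (Num.min x y); first by rewrite lt_min rx.
  have down u t : u \in v :: V -> Num.min x y <= t -> (f u).[t] <= 0 ->
      (f u).[Num.min x y] <= 0.
    move=> /fV[cs [ecs cs0 ->]] mt; case: cs ecs cs0 => // -[p1 c1] cs [/= e1 e2] /andP[/= c10 cs0].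
    rewrite !hornerZ !pmulr_rle0 // -e2 -e1; apply: partial_frac_le0_down => //.
    move=> z; rewrite e2 => /rho_ge zr; apply: le_lt_trans zr _.
    by rewrite lt_min rx.
  move=> u; rewrite inE => /orP[/eqP ->|uV].
    by apply: (down _ y) => //; rewrite ?mem_head // ge_min lexx orbT.
  by apply: (down _ x); rewrite ?inE ?uV ?orbT // ?ge_min ?lexx //; exact: fx.
have := pos x rx; apply/negP; rewrite -leNgt horner_sum big_seq.
by apply: sumr_le0 => v vV; exact: fx.
Qed.

End Selection.

(** * Choosing one vector from each list *)

Section Leaf.
Variable R : rcfType.
Variable n : nat.
Local Notation C := R[i].
Local Notation rc := (real_complex R).
Implicit Types (L : seq (seq 'rV[R]_n)) (M : 'M[R]_n).

(** The sign is opposite to that of [char_poly_mx]: zeros of the determinant are negated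
    eigenvalues, so an upper bound on them bounds the eigenvalues of [M] from below. *)
Definition pencil M : 'M[{poly R}]_n := 'X%:M + map_mx polyC M.

Definition mixed_poly L M : {poly R} :=
  mixed_det (map (map (map_mx polyC)) L) (pencil M).

Lemma pencilD M N : pencil (M + N) = pencil M + map_mx polyC N.
Proof. by rewrite /pencil map_mxD addrA. Qed.

Lemma mixed_poly_cons V L M :
  mixed_poly (V :: L) M = \sum_(v <- V) mixed_poly L (M + rank1 v).
Proof.
rewrite /mixed_poly /= big_map; apply: eq_bigr => v _.
by rewrite pencilD map_rank1.
Qed.

Lemma mixed_poly_horner L M x : (mixed_poly L M).[x] = mixed_det L (x%:M + M).
Proof.
rewrite -[LHS]/(horner_eval x _) /mixed_poly map_mixed_det -map_comp; congr mixed_det.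
  rewrite -[RHS]map_id; apply: eq_map => V /=; rewrite -map_comp -[RHS]map_id.
  by apply: eq_map => v /=; apply/matrixP => i j; rewrite !mxE /horner_eval hornerC.
apply/matrixP => i j; rewrite !mxE /= /horner_eval hornerD hornerC.
by case: eqP => _; rewrite ?mulr1n ?mulr0n ?hornerX ?horner0.
Qed.

Lemma ceval_mixed_poly L M z :
  ceval z (mixed_poly L M) = mixed_det (map (map (map_mx rc)) L) (z%:M + map_mx rc M).
Proof.
rewrite /mixed_poly map_mixed_det -map_comp; congr mixed_det.
  apply: eq_map => V /=; rewrite -map_comp.
  by apply: eq_map => v /=; apply/matrixP => i j; rewrite !mxE /ceval map_polyC hornerC.
apply/matrixP => i j; rewrite !mxE rmorphD; congr (_ + _);
  last by rewrite /= /ceval map_polyC hornerC.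
by case: eqP => _; rewrite ?mulr1n ?mulr0n ?rmorph0 //= /ceval map_polyX hornerX.
Qed.

Definition nonempty_all L := all (fun V => V != [::]) L.
Definition mixed_lead L : R := \prod_(V <- L) (size V)%:R.

Lemma mixed_lead_gt0 L : nonempty_all L -> 0 < mixed_lead L.
Proof.
move=> /allP h; rewrite /mixed_lead big_seq; apply: prodr_gt0 => V /h.
by rewrite ltr0n lt0n size_eq0.
Qed.

Lemma mixed_poly_lead L M : (size (mixed_poly L M - mixed_lead L *: 'X^n)%R <= n)%N.
Proof.
elim: L M => [|V L IH] M.
  rewrite /mixed_lead big_nil scale1r.
  have -> : mixed_poly [::] M = char_poly (- M).
    by rewrite /mixed_poly /= /pencil /char_poly /char_poly_mx map_mxN opprK.
  apply/leq_sizeP => j nj; rewrite coefB coefXn.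
  have [->|ne] := eqVneq j n.
    have /monicP := char_poly_monic (- M).
    by rewrite /lead_coef size_char_poly /= => ->; rewrite subrr.
  by rewrite nth_default ?subr0 // size_char_poly; lia.
rewrite mixed_poly_cons /mixed_lead big_cons -/(mixed_lead L).
have -> : \sum_(v <- V) mixed_poly L (M + rank1 v) - ((size V)%:R * mixed_lead L) *: 'X^n =
    \sum_(v <- V) (mixed_poly L (M + rank1 v) - mixed_lead L *: 'X^n).
  rewrite sumrB; congr (_ - _).
  by rewrite big_const_seq count_predT iter_addr_0 -scalerA scaler_nat.
by apply: leq_trans (size_sum _ _ _) _; apply/bigmax_leqP_seq => v _ _; exact: IH.
Qed.

Lemma map_real_row (v : 'rV[R]_n) : real_row (map_mx rc v).
Proof. by apply/matrixP => i j; rewrite !mxE real_complex_conj. Qed.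

Lemma map_real_vectors L : nonempty_all L -> real_vectors (map (map (map_mx rc)) L).
Proof.
move=> /allP h _ /mapP[V VL ->]; split.
  by have := h V VL; rewrite -!size_eq0 size_map.
by move=> _ /mapP[v _ ->]; exact: map_real_row.
Qed.

Lemma pencil_dissipative M z : M^T = M -> 0 < 'Im z ->
  dissipative (z%:M + map_mx rc M : 'M[C]_n).
Proof.
move=> sM z0; apply: dissipative_scalar_sym => //.
  by rewrite map_trmx sM.
by apply/matrixP => i j; rewrite !mxE real_complex_conj.
Qed.

Lemma mixed_poly_split L M : nonempty_all L -> M^T = M ->
  exists2 s, size s = n & mixed_poly L M = mixed_lead L *: rootprod s.
Proof.
move=> neL sM; have [|s es] := @no_half_plane_root_split R (mixed_poly L M).
  move=> z z0; rewrite ceval_mixed_poly.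
  by have [] := mixed_det_half_plane (map_real_vectors neL) (pencil_dissipative sM z0).
have := mixed_poly_lead L M; set p := mixed_poly L M in es * => sp.
have l0 := mixed_lead_gt0 neL.
have sX : size (mixed_lead L *: 'X^n) = n.+1 by rewrite size_scale ?size_polyXn ?gt_eqF.
have pE : p = mixed_lead L *: 'X^n + (p - mixed_lead L *: 'X^n) by rewrite addrC subrK.
have szp : size p = n.+1 by rewrite pE size_polyDl sX // ltnS.
have lp : lead_coef p = mixed_lead L.
  by rewrite pE lead_coefDl ?sX ?ltnS // lead_coefZ lead_coefXn mulr1.
exists s; last by rewrite -lp.
have := szp; rewrite es size_scale; last by rewrite lp gt_eqF.
by rewrite size_prod_XsubC => -[].
Qed.

Lemma cevalZ z c (p : {poly R}) : ceval z (c *: p) = rc c * ceval z p.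
Proof. by rewrite /ceval map_polyZ hornerZ. Qed.

Lemma rank1_sym (v : 'rV[R]_n) : (rank1 v)^T = rank1 v.
Proof. by rewrite /rank1 trmx_mul trmxK. Qed.

(** The first vector comes from [interlacing_select], with poles at the roots of [mixed_poly] for
    the remaining lists at [M], which do not depend on that vector. *)
Lemma mixed_poly_select L M rho : nonempty_all L -> M^T = M ->
  pos_above rho (mixed_poly L M) ->
  exists vs, [/\ size vs = size L, all2 (fun v V => v \in V) vs L &
    pos_above rho (mixed_poly [::] (M + \sum_(v <- vs) rank1 v))].
Proof.
elim: L M => [|V L IH] M neL sM pos.
  by exists [::]; split=> //; rewrite big_nil addr0.
have /andP[V0 neL'] := neL.
have [s ss es] := mixed_poly_split neL' sM.
have l0 := mixed_lead_gt0 neL'.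
have [||v vV posv] := @interlacing_select R _ V (fun v => mixed_poly L (M + rank1 v)) s _ rho l0 V0.
- move=> v vV.
  set b := (mixed_lead L)^-1 *: (mixed_poly L (M + rank1 v) - mixed_poly L M).
  have bE : mixed_poly L (M + rank1 v) = mixed_lead L *: (rootprod s + b).
    by rewrite scalerDr -es /b scalerA divff ?gt_eqF // scale1r [RHS]addrC subrK.
  have [||cs [pcs cs0 ecs]] := @half_plane_partial_frac R s b.
  (* The leading terms of the two polynomials cancel, so [b] has degree below [n]. *)
  + rewrite ss size_scale ?invr_eq0 ?gt_eqF //.
    have -> : mixed_poly L (M + rank1 v) - mixed_poly L M =
      (mixed_poly L (M + rank1 v) - mixed_lead L *: 'X^n) - (mixed_poly L M - mixed_lead L *: 'X^n).
      by rewrite opprB addrA subrK.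
    apply: leq_trans (size_polyD _ _) _; rewrite size_polyN geq_max.
    by rewrite !mixed_poly_lead.
  + move=> z z0.
    have [_ h] := mixed_det_half_plane (map_real_vectors neL') (pencil_dissipative sM z0).
    have := h _ (map_real_row v); rewrite -map_rank1 -addrA -map_mxD -!ceval_mixed_poly.
    have -> : rootprod s = (mixed_lead L)^-1 *: mixed_poly L M.
      by rewrite es scalerA mulVf ?gt_eqF // scale1r.
    rewrite /b !cevalZ rmorphB /= rmorphM /= real_complex_conj.
    set u := ceval z _; set w := ceval z _; set k := rc _ => hk.
    have -> : k * (u - w) * (k * w^*) = k * k * ((u - w) * w^*) by ring.
    have k0 : 0 < k * k by rewrite mulr_gt0 // /k ltcR invr_gt0.
    rewrite ImMl ?gtr0_real // pmulr_rle0 //.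
    by case: hk => [->|/ltW //]; rewrite mul0r raddf0.
  by exists cs; split=> //; rewrite bE ecs.
- by rewrite -mixed_poly_cons.
have [|vs [svs avs pvs]] := IH (M + rank1 v) neL' _ posv.
  by rewrite linearD /= sM rank1_sym.
exists (v :: vs); split => /=; [by rewrite svs | by rewrite vV |].
by rewrite big_cons addrA.
Qed.

End Leaf.

(** * Sums over all signings *)

Section Matchings.
Variables (U W : finType) (inc : U -> W -> bool).
Implicit Type A : {set U * W}.

Definition is_matching A : bool :=
  [forall a in A, inc a.1 a.2 &&
    [forall b in A, ((a.1 == b.1) || (a.2 == b.2)) ==> (a == b)]].

Lemma is_matchingP A : reflect
  ((forall a, a \in A -> inc a.1 a.2) /\
   (forall a b, a \in A -> b \in A -> (a.1 == b.1) || (a.2 == b.2) -> a = b))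
  (is_matching A).
Proof.
apply: (iffP idP) => [h|[h1 h2]].
  split=> [a aA|a b aA bA ab].
    by move/forall_inP: h => /(_ a aA)/andP[].
  move/forall_inP: h => /(_ a aA)/andP[_ /forall_inP/(_ b bA)].
  by rewrite ab => /eqP.
apply/forall_inP => a aA; rewrite h1 //=; apply/forall_inP => b bA.
by apply/implyP => ab; apply/eqP/h2.
Qed.

Lemma is_matching0 : is_matching set0.
Proof. by apply/is_matchingP; split=> [a|a b]; rewrite inE. Qed.

Lemma matching_card_l A : is_matching A -> #|[set a.1 | a in A]| = #|A|.
Proof.
move=> /is_matchingP[_ h]; apply: card_in_imset => a b aA bA /eqP e.
by apply: h; rewrite ?e.
Qed.

Lemma matching_card_r A : is_matching A -> #|[set a.2 | a in A]| = #|A|.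
Proof.
move=> /is_matchingP[_ h]; apply: card_in_imset => a b aA bA /eqP e.
by apply: h; rewrite ?e ?orbT.
Qed.

Lemma matching_leq A : is_matching A -> (#|A| <= minn #|U| #|W|)%N.
Proof.
move=> mA; rewrite leq_min -{1}(matching_card_l mA) -(matching_card_r mA).
by rewrite !max_card.
Qed.

End Matchings.

Section GodsilGutman.
Variables (R : numFieldType) (n : nat) (W : finType) (inc : 'I_n -> W -> bool).
Local Notation signs := {ffun 'I_n -> bool}.

Definition signrow (w : W) (s : signs) : 'rV[R]_n :=
  \row_u ((inc u w)%:R * (-1) ^+ s u).

Definition signvecs (w : W) : seq 'rV[R]_n := [seq signrow w s | s : signs].

(** Flipping the sign at [u] is an involution that negates every term when [u] and [v] differ. *)
Lemma sum_signs u v :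
  \sum_(s : signs) (-1) ^+ s u * (-1) ^+ s v = (u == v)%:R * #|signs|%:R :> R.
Proof.
have [<-|uv] := eqVneq u v.
  rewrite mul1r -sum1_card natr_sum; apply: eq_bigr => s _.
  by rewrite -exprMn mulrNN mulr1 expr1n.
rewrite mul0r; set S := \sum_s _.
pose flip (s : signs) : signs := [ffun k => if k == u then ~~ s k else s k].
have flipK : involutive flip.
  by move=> s; apply/ffunP => k; rewrite !ffunE; case: eqP => // _; rewrite negbK.
suff : S = - S by move/eqP; rewrite -addr_eq0 -mulr2n mulrn_eq0 => /eqP.
rewrite {1}/S (reindex_inj (inv_inj flipK)) /= -sumrN; apply: eq_bigr => s _.
by rewrite !ffunE eqxx eq_sym (negbTE uv) signrN mulNr.
Qed.

Lemma sum_signvecs_form (Q : 'M[R]_n) w :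
  \sum_(v <- signvecs w) (v *m Q *m v^T) 0 0 = #|signs|%:R * \sum_(u | inc u w) Q u u.
Proof.
rewrite big_image /=.
have E s : (signrow w s *m Q *m (signrow w s)^T) 0 0 =
    \sum_u \sum_v ((inc u w)%:R * (inc v w)%:R * Q v u) * ((-1) ^+ s u * (-1) ^+ s v).
  rewrite !mxE; apply: eq_bigr => u _; rewrite !mxE mulr_suml; apply: eq_bigr => v _.
  by rewrite !mxE; ring.
under eq_bigr => s _ do rewrite E.
rewrite exchange_big /= mulr_sumr [RHS]big_mkcond /=; apply: eq_bigr => u _.
rewrite exchange_big /= (bigD1 u) //= [X in _ + X]big1 ?addr0 => [|v vu].
  rewrite -mulr_sumr sum_signs eqxx.
  by case: (inc u w); rewrite /= ?mul0r // !mul1r mulrC.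
by rewrite -mulr_sumr sum_signs eq_sym (negbTE vu) mul0r mulr0.
Qed.

Lemma delta_rank1 (u : 'I_n) : rank1 (delta_mx 0 u : 'rV[R]_n) = delta_mx u u.
Proof. by rewrite /rank1 trmx_delta mul_delta_mx. Qed.

(** Only the diagonal of the quadratic form survives the sum over signs, and [Q u u] is the
    increment caused by adding [delta_mx u u]. *)
Lemma mixed_det_signvecs L M w :
  mixed_det (signvecs w :: L) M = #|signs|%:R * (mixed_det L M +
    \sum_(u | inc u w) (mixed_det L (M + delta_mx u u) - mixed_det L M)).
Proof.
have [Q HQ] := mixed_det_rank1 L M.
have HQ1 v : mixed_det L (M + rank1 v) = mixed_det L M + (v *m Q *m v^T) 0 0.
  by rewrite -[rank1 v]scale1r HQ mul1r.
rewrite /=; under eq_bigr => v _ do rewrite HQ1.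
rewrite big_split /= sum_signvecs_form big_const_seq count_predT size_image iter_addr_0.
rewrite mulrDr; congr (_ + _); first by rewrite mulr_natl.
congr (_ * _); apply: eq_bigr => u _.
rewrite -delta_rank1 HQ1 addrAC subrr add0r mxE (bigD1 u) //= big1 ?addr0.
  rewrite !mxE !eqxx mulr1 (bigD1 u) //= big1 ?addr0 ?mxE ?eqxx ?mul1r // => k ku.
  by rewrite mxE eqxx (negbTE ku) mul0r.
by move=> k ku; rewrite !mxE (negbTE ku) andbF mulr0.
Qed.

Definition matchings_in (ws : seq W) (A : {set 'I_n * W}) :=
  is_matching inc A && [forall a in A, a.2 \in ws].

Definition free_prod (y : 'I_n -> R) (A : {set 'I_n * W}) :=
  \prod_(u | u \notin [set a.1 | a in A]) y u.

(** A matching either misses [w] or contains exactly one pair [(u, w)]; removing it leaves a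
    matching in [ws] that misses [u]. *)
Lemma matchings_in_cons w ws (g : {set 'I_n * W} -> R) : w \notin ws ->
  \sum_(A | matchings_in (w :: ws) A) g A =
  \sum_(A | matchings_in ws A) g A +
  \sum_(u | inc u w) \sum_(A | matchings_in ws A && (u \notin [set a.1 | a in A]))
     g ((u, w) |: A).
Proof.
move=> wws.
rewrite (bigID (fun A : {set 'I_n * W} => [forall u, (u, w) \notin A])) /=; congr (_ + _).
  apply: eq_bigl => A; rewrite /matchings_in -andbA; congr (_ && _).
  apply/andP/forall_inP => [[/forall_inP h /forallP h2] a aA|h].
    have := h a aA; rewrite inE => /orP[/eqP aw|//].
    by have := h2 a.1; rewrite -aw -surjective_pairing aA.
  split; first by apply/forall_inP => a /h; rewrite inE orbC => ->.
  by apply/forallP => u; apply/negP => /h /=; rewrite (negbTE wws).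
transitivity (\sum_u \sum_(A | matchings_in (w :: ws) A && ((u, w) \in A)) g A).
  rewrite (exchange_big_dep (fun A : {set 'I_n * W} =>
    matchings_in (w :: ws) A && ~~ [forall u, (u, w) \notin A])) /=.
    apply: eq_bigr => A /andP[mA]; rewrite negb_forall => /existsP[u].
    rewrite negbK => uA; rewrite (big_pred1 u) // => k; rewrite mA /=.
    apply/idP/eqP => [kA|->//].
    have /andP[/is_matchingP[_ h] _] := mA.
    by have := h _ _ kA uA; rewrite /= eqxx orbT => /(_ isT) [].
  move=> u A _ /andP[-> uA] /=; rewrite negb_forall; apply/existsP; exists u.
  by rewrite negbK.
rewrite [RHS]big_mkcond /=; apply: eq_bigr => u _.
case: ifP => [iu|iu]; last first.
  rewrite big1 // => A /andP[/andP[/is_matchingP[h _] _] /h] /=.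
  by rewrite iu.
rewrite (reindex_onto (fun A : {set 'I_n * W} => (u, w) |: A)
  (fun A => A :\ (u, w))) /=; last first.
  by move=> A /andP[_ uA]; rewrite setD1K.
apply: eq_bigl => A; apply/andP/andP.
  case=> /andP[/andP[/is_matchingP[h1 h2] /forall_inP h3] _] /eqP e.
  have uA : (u, w) \notin A by rewrite -e !inE eqxx.
  have inA a : a \in A -> a \in (u, w) |: A by move=> aA; rewrite !inE aA orbT.
  split; last first.
    apply/imsetP => -[a aA ua].
    have := h2 (u, w) a; rewrite !inE aA orbT eqxx /= ua eqxx => /(_ isT isT isT) ea.
    by rewrite ua ea aA in uA.
  apply/andP; split.
    apply/is_matchingP; split=> [a /inA/h1//|a b /inA aA /inA bA]; exact: h2.
  apply/forall_inP => a aA; have := h3 a (inA a aA); rewrite inE => /orP[/eqP aw|//].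
  have := h2 (u, w) a; rewrite !inE aA orbT eqxx /= aw eqxx orbT => /(_ isT isT isT) ea.
  by rewrite ea aA in uA.
case=> /andP[/is_matchingP[h1 h2] /forall_inP h3] uA.
have uwA : (u, w) \notin A.
  by apply: contra wws => /h3.
split; last by rewrite setU1K.
rewrite setU11 andbT; apply/andP; split; last first.
  apply/forall_inP => a; rewrite !inE => /orP[/eqP ->|/h3 ->]; rewrite ?eqxx ?orbT //.
have dif a : a \in A -> (a.1 == u) || (a.2 == w) = false.
  move=> aA; apply/negbTE; rewrite negb_or; apply/andP; split.
    by apply: contra uA => /eqP <-; apply/imsetP; exists a.
  by apply: contraNneq wws => <-; exact: h3.
apply/is_matchingP; split=> [a|a b]; rewrite !inE.
  by move=> /orP[/eqP -> //|/h1].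
move=> /orP[/eqP ->|aA] /orP[/eqP ->|bA] //=; last exact: h2.
  by rewrite eq_sym [w == _]eq_sym dif.
by rewrite dif.
Qed.

(** The product is affine in [y u], so a unit increment acts as a partial derivative. *)
Lemma free_prod_delta y A u :
  free_prod (fun k => y k + (k == u)%:R) A - free_prod y A =
  if u \in [set a.1 | a in A] then 0
  else \prod_(k | (k \notin [set a.1 | a in A]) && (k != u)) y k.
Proof.
rewrite /free_prod; case: ifPn => uA.
  apply/eqP; rewrite subr_eq0; apply/eqP; apply: eq_bigr => k kA.
  by have [e|] := eqVneq k u; [rewrite e uA in kA | rewrite addr0].
rewrite (bigD1 u) //= [X in _ - X](bigD1 u) //= eqxx.
under eq_bigr => k /andP[_ ku] do rewrite (negbTE ku) addr0.
by rewrite mulrDl mul1r addrAC subrr add0r.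
Qed.

(** Godsil-Gutman averaging: both sides obey the same recursion, the new column being unmatched or
    matched to a row [u] whose factor disappears. The diagonal is general because the updates
    [delta_mx u u] change single entries. *)
Lemma mixed_det_matching ws (y : 'I_n -> R) : uniq ws ->
  mixed_det (map signvecs ws) (diag_mx (\row_u y u)) =
  #|signs|%:R ^+ size ws * \sum_(A | matchings_in ws A) free_prod y A.
Proof.
elim: ws y => [|w ws IH] y.
  move=> _ /=; rewrite det_diag mul1r (big_pred1 set0).
    rewrite /free_prod imset0; apply: eq_big => [u|u _]; rewrite ?inE ?mxE //.
  move=> A; apply/andP/eqP => [[_ /forall_inP h]|->].
    by apply/setP => a; rewrite inE; apply/negP => /h.
  by rewrite is_matching0; split=> //; apply/forall_inP => a; rewrite inE.
case/andP=> wws uws; rewrite [map _ _]/= mixed_det_signvecs matchings_in_cons //.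
rewrite exprS -mulrA; congr (_ * _); rewrite mulrDr IH //; congr (_ + _).
rewrite [RHS]mulr_sumr; apply: eq_bigr => u _.
have -> : diag_mx (\row_k y k) + delta_mx u u = diag_mx (\row_k (y k + (k == u)%:R)).
  apply/matrixP => i j; rewrite !mxE; have [->|ij] := eqVneq i j.
    by rewrite !mulr1n andbb.
  rewrite !mulr0n add0r; case: eqP => // iu; case: eqP => // ju.
  by rewrite iu ju eqxx in ij.
rewrite !IH // -mulrBr -sumrB; congr (_ * _); rewrite [RHS]big_mkcondr /=.
apply: eq_bigr => A _; rewrite free_prod_delta; case: ifP => //= uA.
by apply: eq_bigl => k; rewrite imsetU1 in_setU1 negb_or andbC.
Qed.

Lemma mixed_det_matching_scalar x :
  mixed_det (map signvecs (enum W)) x%:M =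
  #|signs|%:R ^+ #|W| * \sum_(A | is_matching inc A) x ^+ (n - #|A|).
Proof.
have -> : x%:M = diag_mx (\row_(u < n) x).
  by rewrite -diag_const_mx; congr diag_mx; apply/rowP => i; rewrite !mxE.
rewrite mixed_det_matching ?enum_uniq // -cardT; congr (_ * _).
apply: eq_big => [A|A].
  rewrite /matchings_in; have [|//] := boolP (is_matching inc A) => _ /=.
  by apply/forall_inP => a _; rewrite mem_enum.
move=> /andP[mA _]; rewrite /free_prod prodr_const; congr (_ ^+ _).
have := cardsC [set a.1 | a in A]; rewrite card_ord (matching_card_l mA).
move=> /(congr1 (fun k => k - #|A|)%N); rewrite addKn => <-.
by apply: eq_card => u; rewrite inE.
Qed.

End GodsilGutman.

(** * Matching polynomial of the incidence graph *)

Definition signed_inc (R : nzRingType) n m (inc : 'I_n -> 'I_m -> bool)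
    (s : 'I_n -> 'I_m -> bool) : 'M[R]_(n, m) :=
  \matrix_(u, w) ((inc u w)%:R * (-1) ^+ s u w).

Lemma signvecs_choice (R : numFieldType) n (W : finType) (inc : 'I_n -> W -> bool) ws vs :
  uniq ws -> all2 (fun v V => v \in V) vs (map (signvecs R inc) ws) ->
  exists S : W -> {ffun 'I_n -> bool}, vs = [seq signrow R inc w (S w) | w <- ws].
Proof.
elim: ws vs => [|w ws IH] [|v vs] //=; first by exists (fun=> [ffun=> false]).
move=> /andP[wws uws] /andP[/imageP[s _ ->] /(IH _ uws)[S ->]].
exists (fun k => if k == w then s else S k); rewrite eqxx; congr cons.
apply/eq_in_map => k kws; case: eqP => // kw.
by rewrite -kw kws in wws.
Qed.

(** At the zero matrix the sum over all signings is a positive multiple of the matching sum, so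
    selection applies; the chosen rank-one terms add up to the Gram matrix. *)
Lemma exists_signing (R : rcfType) n m (inc : 'I_n -> 'I_m -> bool) (rho : R) :
  (forall x, rho < x -> 0 < \sum_(A | is_matching inc A) x ^+ (n - #|A|)) ->
  exists s, forall x, rho < x ->
    0 < \det (x%:M + signed_inc R inc s *m (signed_inc R inc s)^T).
Proof.
move=> pos; pose L := map (signvecs R inc) (enum 'I_m).
have neL : nonempty_all L.
  apply/allP => _ /mapP[w _ ->]; rewrite -size_eq0 size_image -lt0n.
  by apply/card_gt0P; exists [ffun=> false].
have posL : pos_above rho (mixed_poly L 0).
  move=> x rx; rewrite mixed_poly_horner addr0 mixed_det_matching_scalar.
  rewrite mulr_gt0 ?pos // exprn_gt0 // ltr0n.
  by apply/card_gt0P; exists [ffun=> false].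
have [vs [_ avs pvs]] := mixed_poly_select neL (trmx0 _ _ _) posL.
have [S vsE] := signvecs_choice (enum_uniq _) avs.
exists (fun u w => S w u) => x /pvs; rewrite mixed_poly_horner add0r /=.
congr (0 < \det (_ + _)); rewrite vsE big_map.
apply/matrixP => i j; rewrite summxE mxE big_enum /=; apply: eq_bigr => w _.
by rewrite /rank1 !mxE big_ord1 !mxE.
Qed.

(** Serves to renumber vertices and edges by ordinals; [h] may also exchange the two sides. *)
Lemma sum_matching_bij (R : nzRingType) (U W U' W' : finType)
    (inc : U -> W -> bool) (inc' : U' -> W' -> bool) (h : U * W -> U' * W') (g : nat -> R) :
  bijective h -> (forall a, inc' (h a).1 (h a).2 = inc a.1 a.2) ->
  (forall a b, ((h a).1 == (h b).1) || ((h a).2 == (h b).2) =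
               (a.1 == b.1) || (a.2 == b.2)) ->
  \sum_(A | is_matching inc' A) g #|A| = \sum_(A | is_matching inc A) g #|A|.
Proof.
move=> bh hinc hcf; have ih := bij_inj bh.
have [h' hK h'K] := bh.
rewrite (reindex (fun A : {set U * W} => h @: A)) /=; last first.
  apply: onW_bij; exists (fun A : {set U' * W'} => h' @: A) => A; rewrite -imset_comp.
    by rewrite (eq_imset _ hK) imset_id.
  by rewrite (eq_imset _ h'K) imset_id.
apply: eq_big => [A|A _]; last by rewrite card_imset.
apply/is_matchingP/is_matchingP => -[h1 h2]; split.
- by move=> a aA; rewrite -hinc; apply: h1; exact: imset_f.
- by move=> a b aA bA ab; apply: ih; apply: h2; rewrite ?imset_f // hcf.
- by move=> _ /imsetP[a aA ->]; rewrite hinc; exact: h1.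
- move=> _ _ /imsetP[a aA ->] /imsetP[b bA ->]; rewrite hcf => ab.
  by rewrite (h2 a b).
Qed.

Section MatchingPoly.
Variable H : hypergraph.

Definition hinc (v : vertex H) (e : edge H) : bool := v \in verts e.

Definition hpair (a : vertex H * edge H) : {set vertex H + edge H} :=
  [set inl a.1; inr a.2].

Lemma hpair_inj : injective hpair.
Proof.
move=> [v e] [v' e'] /setP h.
have := h (inl v); have := h (inr e); rewrite !inE /= !eqxx ?orbT /= ?orbF.
by move=> /esym/eqP[->] /esym/eqP[->].
Qed.

Lemma hpair_disjoint a b : [disjoint hpair a & hpair b] = ~~ ((a.1 == b.1) || (a.2 == b.2)).
Proof.
rewrite -setI_eq0; apply/eqP/norP => [h|[/eqP h1 /eqP h2]].
  split; apply/eqP => e.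
    by have /setP/(_ (inl a.1)) := h; rewrite !inE e eqxx.
  by have /setP/(_ (inr a.2)) := h; rewrite !inE e eqxx orbT.
apply/setP => -[v|e]; rewrite !inE /=; apply/negP => /andP[].
  by rewrite !orbF => /eqP[->] /eqP[].
by move=> /eqP[->] /eqP[].
Qed.

(** An edge of the incidence graph has one end on each side, so [hpair] identifies incident pairs
    with edges. *)
Lemma card_matchings i :
  #|matchings (@incidence_graph H) i| = #|[set A | is_matching hinc A & #|A| == i]|.
Proof.
rewrite -(card_imset _ (imset_inj hpair_inj)); apply: eq_card => M.
apply/idP/imsetP => [|[A]].
  rewrite inE => /and3P[/subsetP Mg tM /eqP Mi].
  pose A := [set a | hpair a \in M].
  have ME : M = hpair @: A.
    apply/setP => X; apply/idP/imsetP => [XM|[a]]; last by rewrite inE => ? ->.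
    have := Mg X XM => /imsetP[[[v|e] [w|f]]]; rewrite inE //= => vf XE.
      by exists (v, f); rewrite ?inE /hpair -?XE.
    by exists (w, e); rewrite ?inE /hpair setUC -?XE.
  exists A => //; rewrite inE -Mi ME (card_imset _ hpair_inj) eqxx andbT.
  apply/is_matchingP; split.
    move=> [v e]; rewrite inE => /Mg/imsetP[[[x|x] [y|y]]]; rewrite inE //= => xy /setP XE.
      have := XE (inl v); have := XE (inr e); rewrite !inE /= !eqxx ?orbT ?orbF /=.
      by move=> /esym/eqP[->] /esym/eqP[->].
    have := XE (inl v); have := XE (inr e); rewrite !inE /= !eqxx ?orbT ?orbF /=.
    by move=> /esym/eqP[->] /esym/eqP[->].
  move=> a b; rewrite !inE => aM bM; apply: contraTeq => ab; rewrite -hpair_disjoint.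
  by apply: (trivIsetP tM) => //; rewrite (inj_eq hpair_inj).
rewrite inE => /andP[/is_matchingP[h1 h2] /eqP Ai] ->.
rewrite inE (card_imset _ hpair_inj) Ai eqxx andbT; apply/andP; split.
  apply/subsetP => _ /imsetP[a aA ->]; apply/imsetP.
  by exists (inl a.1, inr a.2) => //; rewrite inE /=; exact: h1.
apply/trivIsetP => _ _ /imsetP[a aA ->] /imsetP[b bA ->] ab.
rewrite hpair_disjoint; apply: contra ab => ab.
by rewrite (h2 a b).
Qed.

Lemma matching_polyE (R : nzRingType) :
  matching_poly (@incidence_graph H) R =
  \sum_(A | is_matching hinc A) (-1) ^+ #|A| *: 'X^(nu H + ne H - 2 * #|A|).
Proof.
rewrite /matching_poly card_sum.
have ltA A : is_matching hinc A -> (#|A| < ((nu H + ne H)./2).+1)%N.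
  move=> /matching_leq; rewrite -/(nu H) -/(ne H) ltnS leq_min => /andP[h1 h2]; lia.
rewrite (partition_big (fun A : {set vertex H * edge H} =>
  inord #|A| : 'I_((nu H + ne H)./2).+1) xpredT) //=.
apply: eq_bigr => i _; rewrite card_matchings.
transitivity (\sum_(A in [set A | is_matching hinc A & #|A| == i])
    ((-1) ^+ i *: 'X^(nu H + ne H - 2 * i)) : {poly R}).
  by rewrite sumr_const -scaler_nat scalerA commr_nat.
apply: eq_big => [A|A].
  rewrite inE; have [mA|//] := boolP (is_matching hinc A); rewrite /=.
  by rewrite -val_eqE /= inordK // ltA.
by rewrite inE => /andP[_ /eqP ->].
Qed.

End MatchingPoly.

(** * Real roots with multiplicity *)

Section RealRoots.
Variable R : rcfType.
Implicit Types (p q : {poly R}) (s t u : seq R).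

Lemma real_roots_sorted p : sorted >=%R (real_roots p).
Proof. by apply: sort_sorted; exact: ge_total. Qed.

Lemma count_real_roots p x : p != 0 -> count_mem x (real_roots p) = mup x p.
Proof.
move=> p0; rewrite /real_roots count_sort count_flatten -map_comp.
have rp : (x \in rootsR p) = root p x.
  by have := roots_on_rootsR p0 x; rewrite inE /= => ->.
rewrite sumnE big_map; have [xr|xr] := boolP (root p x); last first.
  rewrite (mupNroot xr) big_seq big1 // => y yr /=; rewrite count_nseq /=.
  case: eqP => [e|_]; last by rewrite mul0n.
  by rewrite -rp -e yr in xr.
have ur : uniq (rootsR p) by rewrite (sorted_uniq lt_trans ltxx) // sorted_roots.
rewrite (bigD1_seq x) ?rp //= count_nseq /= eqxx mul1n.
by rewrite big1 ?addn0 // => y yx; rewrite count_nseq /= (negbTE yx) mul0n.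
Qed.

Lemma rootprod_dvdp s p : p != 0 ->
  (forall x, count_mem x s <= mup x p)%N -> rootprod s %| p.
Proof.
elim: s p => [|x s IH] p p0 h; first by rewrite /rootprod big_nil dvd1p.
have : 'X - x%:P %| p by rewrite XsubC_dvd //; apply: leq_trans (h x) => /=; rewrite eqxx.
case/dvdpP=> q pE; have q0 : q != 0 by apply: contraNneq p0 => q0; rewrite pE q0 mul0r.
rewrite rootprod_cons pE mulrC dvdp_mul2r ?polyXsubC_eq0 //.
apply: IH => // y; have := h y; rewrite pE mupM ?polyXsubC_eq0 //=.
by have := mup_XsubCX 1 y x; rewrite expr1 => ->; case: eqP; lia.
Qed.

Lemma rootprod_monic s : rootprod s \is monic.
Proof. exact: monic_prod_XsubC. Qed.

Lemma rootprod_neq0 s : rootprod s != 0.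
Proof. exact: monic_neq0 (rootprod_monic s). Qed.

Lemma rootprod_coprimep s q : (forall x, x \in s -> ~~ root q x) -> coprimep (rootprod s) q.
Proof.
elim: s => [|x s IH] h; first by rewrite /rootprod big_nil coprime1p.
rewrite rootprod_cons coprimepMl coprimep_sym coprimep_XsubC h ?mem_head //=.
by apply: IH => y ys; apply: h; rewrite inE ys orbT.
Qed.

Lemma perm_real_roots_mul p q : p != 0 -> q != 0 ->
  perm_eq (real_roots (p * q)) (real_roots p ++ real_roots q).
Proof.
move=> p0 q0; apply/allP => x _ /=.
by rewrite count_cat !count_real_roots ?mulf_neq0 // mupM.
Qed.

Lemma perm_real_roots_rootprod s : perm_eq (real_roots (rootprod s)) s.
Proof.
by apply/allP => x _ /=; rewrite count_real_roots ?rootprod_neq0 // mu_prod_XsubC.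
Qed.

Lemma seq_diff_cat s t u : perm_eq s (t ++ u) -> perm_eq (seq_diff s t) u.
Proof.
elim: t u => [|x t IH] u //= h.
have h' : perm_eq (seq_diff s t) (x :: u).
  by apply: IH; rewrite (permPl h) perm_sym -cat1s perm_catCA.
have xs : x \in seq_diff s t by rewrite (perm_mem h') mem_head.
by rewrite -(perm_cons x) -(permPl (perm_to_rem xs)).
Qed.

Lemma seq_diff_sorted s t : sorted >=%R s -> sorted >=%R (seq_diff s t).
Proof.
move=> ss; elim: t => [|x t IH] //=.
by apply: (subseq_sorted ge_trans) IH; exact: rem_subseq.
Qed.

Lemma seq_diff_real_roots p q : p != 0 -> q != 0 ->
  seq_diff (real_roots (p * q)) (real_roots p) = real_roots q.
Proof.
move=> p0 q0; apply: (sorted_eq ge_trans ge_anti).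
- exact/seq_diff_sorted/real_roots_sorted.
- exact: real_roots_sorted.
- exact/seq_diff_cat/perm_real_roots_mul.
Qed.

Lemma take_sorted_ge s c k : sorted >=%R s -> (k <= count (>= c) s)%N ->
  forall x, x \in take k s -> c <= x.
Proof.
elim: s k => [|y s IH] [|k] //= ys.
have ss := path_sorted ys.
have [cy|yc] := leP c y.
  by rewrite add1n ltnS => h x; rewrite inE => /orP[/eqP -> //|]; exact: IH.
rewrite add0n => h; have : has (>= c) s by rewrite has_count (leq_trans _ h).
case/hasP=> z zs cz; move: ys; rewrite (path_sortedE ge_trans) => /andP[/allP/(_ z zs) zy _].
by have := lt_le_trans yc (le_trans cz zy); rewrite ltxx.
Qed.

End RealRoots.

(** * Positivity of the matching sum *)

Section Positivity.
Variables (R : rcfType) (H : hypergraph).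

(** The matching polynomial without its factor ['X^(nu H + ne H - 2 * tau H)]; being even, it has
    roots symmetric about 0. *)
Let g : {poly R} := \sum_(A | is_matching (@hinc H) A) (-1) ^+ #|A| *: 'X^(2 * (tau H - #|A|)).

Let leA A : is_matching (@hinc H) A -> (#|A| <= tau H)%N.
Proof. exact: matching_leq. Qed.

Let gE : matching_poly (@incidence_graph H) R = 'X^(nu H + ne H - 2 * tau H) * g.
Proof.
rewrite matching_polyE mulr_sumr; apply: eq_bigr => A /leA lA.
rewrite -scalerAr -exprD; congr (_ *: 'X^ _).
have : (tau H <= nu H)%N by exact: geq_minl.
have : (tau H <= ne H)%N by exact: geq_minr.
lia.
Qed.

Let g_lead : size g = (2 * tau H).+1 /\ g \is monic.
Proof.
have -> : g = 'X^(2 * tau H) + \sum_(A | is_matching (@hinc H) A && (A != set0))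
   (-1) ^+ #|A| *: 'X^(2 * (tau H - #|A|)).
  by rewrite /g (bigD1 set0) ?is_matching0 //= cards0 expr0 scale1r subn0.
set q := \sum_(A | _) _.
have sq : (size q < size ('X^(2 * tau H) : {poly R}))%N.
  rewrite size_polyXn ltnS; apply: leq_trans (size_sum _ _ _) _.
  apply/bigmax_leqP => A /andP[/leA lA A0]; apply: leq_trans (size_scale_leq _ _) _.
  rewrite size_polyXn; move: A0; rewrite -card_gt0; lia.
split; first by rewrite size_polyDl // size_polyXn.
by rewrite monicE lead_coefDl // lead_coefXn.
Qed.

(** For t > 0 the [tau H] largest roots y and their negatives exhaust the roots of [g], so [g] is
    the product of the X^2 - y^2. At x = -z^2 the sum is therefore the product of the y^2 - z^2,
    positive for z < t. *)
Lemma matching_sum_gt0 (t : R) : 0 <= t -> (0 < tau H)%N ->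
  t <= kth_largest_root (matching_poly (@incidence_graph H) R) (tau H) ->
  forall x, - t ^+ 2 < x -> 0 < \sum_(A | is_matching (@hinc H) A) x ^+ (tau H - #|A|).
Proof.
move=> t0 tau0 root_t x tx.
have [x0|x0] := ltP 0 x.
  rewrite (bigD1 set0) ?is_matching0 //=; apply: ltr_wpDr; last by rewrite exprn_gt0.
  by apply: sumr_ge0 => A _; rewrite exprn_ge0 // ltW.
have {t0} t0 : 0 < t.
  by rewrite lt_def t0 andbT; apply: contraTneq tx => ->; rewrite expr0n oppr0 -leNgt.
set mu := matching_poly _ R in root_t.
have [sg mg] := g_lead; have g0 := monic_neq0 mg.
have mu0 : mu != 0 by rewrite /mu gE mulf_neq0 // monic_neq0 ?monicXn.
pose xs := take (tau H) (real_roots mu).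
(* For a shorter list [nth] would return its default 0, against [0 < t]. *)
have szr : (tau H <= size (real_roots mu))%N.
  rewrite leqNgt; apply/negP => lt; move: root_t; rewrite /kth_largest_root nth_default.
    by rewrite leNgt t0.
  by rewrite -ltnS prednK.
have sxs : size xs = tau H by rewrite size_takel.
have xs_ge y : y \in xs -> t <= y.
  move=> yxs; apply: le_trans root_t _; have := yxs.
  case/(nthP 0) => i; rewrite sxs => ilt <-; rewrite nth_take //.
  have h1 : (tau H).-1 \in [pred k | (k < size (real_roots mu))%N].
    by rewrite inE; apply: leq_trans szr; rewrite prednK.
  have h2 : i \in [pred k | (k < size (real_roots mu))%N].
    by rewrite inE; apply: leq_trans szr.
  apply: (sorted_leq_nth ge_trans (@lexx _ _) 0 (real_roots_sorted mu) i _ h2 h1).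
  by rewrite -ltnS prednK.
have d1 : rootprod xs %| g.
  have : rootprod xs %| mu.
    apply: rootprod_dvdp => // y; rewrite -count_real_roots //.
    by rewrite -[X in (_ <= count_mem y X)%N](cat_take_drop (tau H)) count_cat leq_addr.
  rewrite /mu gE Gauss_dvdpr //; apply: rootprod_coprimep => y /xs_ge ty.
  rewrite /root hornerXn expf_neq0 // gt_eqF //; exact: lt_le_trans ty.
have d2 : rootprod (map -%R xs) %| g.
  have := dvdp_comp_poly (- 'X) d1.
  have -> : g \Po (- 'X) = g.
    rewrite /g raddf_sum /=; apply: eq_bigr => A _; rewrite comp_polyZ comp_Xn_poly.
    by rewrite !exprM sqrrN.
  suff -> : rootprod xs \Po (- 'X) = (-1) ^+ size xs *: rootprod (map -%R xs).
    by rewrite dvdpZl // signr_eq0.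
  elim: (xs) => [|y s IH]; first by rewrite /rootprod !big_nil comp_polyC expr0 scale1r.
  rewrite /= !rootprod_cons comp_polyM IH comp_polyB comp_polyX comp_polyC.
  by rewrite exprS -!mul_polyC rmorphN rmorphM rmorphN rmorph1; ring.
have cop : coprimep (rootprod xs) (rootprod (map -%R xs)).
  apply: rootprod_coprimep => y /xs_ge ty; rewrite root_prod_XsubC.
  apply/mapP => -[z /xs_ge tz e]; move: tz ty; rewrite e; lra.
have gP : g = rootprod xs * rootprod (map -%R xs).
  have d : rootprod xs * rootprod (map -%R xs) %| g by rewrite Gauss_dvdp // d1 d2.
  (* Both polynomials are monic of degree [2 * tau H], so divisibility gives equality. *)
  apply/eqP; rewrite eq_sym -eqp_monic ?monicMl ?rootprod_monic //.
  rewrite -(dvdp_size_eqp d) sg size_Mmonic ?rootprod_neq0 ?rootprod_monic //.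
  by rewrite !size_prod_XsubC size_map sxs; lia.
pose z := Num.sqrt (- x).
have z2 : z ^+ 2 = - x by rewrite sqr_sqrtr // oppr_ge0.
have z0 : 0 <= z by exact: sqrtr_ge0.
have zt : z < t by rewrite -(ltr_pXn2r (_ : 0 < 2)%N) ?nnegrE // ?ltW // z2; lra.
have xE : x = - z ^+ 2 by rewrite z2 opprK.
have -> : \sum_(A | is_matching (@hinc H) A) x ^+ (tau H - #|A|) = (-1) ^+ tau H * g.[z].
  rewrite /g horner_sum mulr_sumr; apply: eq_bigr => A /leA lA.
  rewrite hornerZ hornerXn exprM {1}xE [LHS]exprNn mulrA; congr (_ * _).
  by rewrite -exprD -signr_odd oddB // -oddD signr_odd.
rewrite gP hornerM -sxs.
have -> : (-1) ^+ size xs * ((rootprod xs).[z] * (rootprod (map -%R xs)).[z]) =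
   \prod_(y <- xs) ((y - z) * (z + y)).
  elim: (xs) => [|y s IH]; first by rewrite /rootprod !big_nil hornerC !mulr1.
  by rewrite /= !rootprod_cons big_cons -IH !hornerM !hornerXsubC exprS; ring.
rewrite big_seq; apply: prodr_gt0 => y /xs_ge ty.
by rewrite mulr_gt0 //; lra.
Qed.

End Positivity.

(** * Signed 2-covers *)

Lemma det_mxsub_bij (R : comNzRingType) m n (h : 'I_m -> 'I_n) (B : 'M[R]_n) :
  bijective h -> \det (\matrix_(i, j) B (h i) (h j)) = \det B.
Proof.
move=> bh; have := bij_eq_card bh; rewrite !card_ord => mn.
subst n.
pose s := perm (bij_inj bh).
have -> : \matrix_(i, j) B (h i) (h j) = row_perm s (col_perm s B).
  by apply/matrixP => i j; rewrite !mxE !permE.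
rewrite row_permE col_permE !det_mulmx !det_perm odd_permV.
by rewrite mulrCA -signr_addb addbb mulr1.
Qed.

Lemma char_poly_mxsub_bij (R : comNzRingType) m n (h : 'I_m -> 'I_n) (B : 'M[R]_n) :
  bijective h -> char_poly (\matrix_(i, j) B (h i) (h j)) = char_poly B.
Proof.
move=> bh; rewrite /char_poly -(det_mxsub_bij (char_poly_mx B) bh); congr (\det _).
by apply/matrixP => i j; rewrite !mxE (inj_eq (bij_inj bh)).
Qed.

Lemma det_block_circ (R : comNzRingType) n (P Q : 'M[R]_n) :
  \det (block_mx P Q Q P) = \det (P + Q) * \det (P - Q).
Proof.
have E : block_mx 1%:M 1%:M 0 1%:M *m block_mx P Q Q P *m block_mx 1%:M (- 1%:M) 0 1%:M =
    block_mx (P + Q) 0 Q (P - Q).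
  rewrite !mulmx_block !(mul1mx, mul0mx, mulmx1, mulmx0, addr0, add0r) !mulmxN !mulmx1.
  by rewrite [Q + P]addrC addNr [- Q + P]addrC.
have := congr1 determinant E.
by rewrite !det_mulmx !det_ublock det_lblock !det1 !mul1r !mulr1.
Qed.

Lemma char_poly_block_circ (R : comNzRingType) n (P Q : 'M[R]_n) :
  char_poly (block_mx P Q Q P) = char_poly (P + Q) * char_poly (P - Q).
Proof.
rewrite /char_poly /char_poly_mx map_block_mx.
rewrite scalar_mx_block opp_block_mx add_block_mx !add0r det_block_circ.
by rewrite !(map_mxD, map_mxN) opprK !opprD opprK !addrA.
Qed.

(* Sylvester's determinant identity, with denominators cleared. *)
Lemma det_scalar_sub_mulmx (R : comNzRingType) n m (a : R) (N : 'M[R]_(n, m)) (M : 'M[R]_(m, n)) :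
  a ^+ m * \det (a%:M - N *m M) = a ^+ n * \det (a%:M - M *m N).
Proof.
pose B := block_mx a%:M N M 1%:M : 'M_(n + m).
have E1 : B *m block_mx 1%:M 0 (- M) 1%:M = block_mx (a%:M - N *m M) N 0 1%:M.
  rewrite mulmx_block !(mulmx1, mulmx0, mul1mx, mul0mx, addr0, add0r) mulmxN.
  by rewrite subrr.
have E2 : block_mx 1%:M 0 (- M) a%:M *m B = block_mx a%:M N 0 (a%:M - M *m N).
  rewrite mulmx_block !(mulmx1, mulmx0, mul1mx, mul0mx, addr0, add0r) !mulNmx.
  by rewrite mul_mx_scalar mul_scalar_mx addNr [- _ + _]addrC.
have := congr1 determinant E1; have := congr1 determinant E2.
rewrite !det_mulmx !det_lblock !det_ublock !det1 !det_scalar !mul1r !mulr1.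
by move=> e2 e1; rewrite -e1 -e2.
Qed.

Section Cover.
Variables (H : hypergraph) (s : vertex H -> edge H -> bool).

(** The double cover of the incidence graph given by [s]: an incidence with sign [true] joins
    opposite sheets. *)
Definition cover_verts (eb : edge H * bool) : {set vertex H * bool} :=
  [set vb | (vb.1 \in verts eb.1) && (vb.2 == eb.2 (+) s vb.1 eb.1)].

Definition cover : hypergraph := Hypergraph cover_verts.

Lemma cover_is_2cover : @is_2cover cover H fst fst.
Proof.
split.
- by move=> v; exists (v, false).
- move=> v; have -> : [set vb : vertex cover | vb.1 == v] = [set (v, false); (v, true)].
    by apply/setP => -[u b]; rewrite !inE /= !xpair_eqE; case: b; rewrite ?andbT ?andbF ?orbF.
  by rewrite cards2 xpair_eqE eqxx.
- move=> [e b]; split.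
    by move=> [u a] [v c]; rewrite !inE /= => /andP[_ /eqP ->] /andP[_ /eqP ->] ->.
  apply/setP => v; apply/imsetP/idP => [[[u a]]|ve].
    by rewrite inE => /andP[/= ue _] ->.
  by exists (v, b (+) s v e) => //; rewrite inE /= ve eqxx.
- move=> [v a]; split.
    move=> [e b] [f c]; rewrite !inE /= => /andP[_ /eqP ->] /andP[_ /eqP] h ef.
    rewrite ef; congr pair; move: h; rewrite -ef; move=> /(congr1 (fun z => z (+) s v e)).
    by rewrite !addbK.
  apply/setP => e; apply/imsetP/idP => [[[f b]]|].
    by rewrite !inE => /andP[/= vf _] ->.
  rewrite inE => ve; exists (e, a (+) s v e) => //.
  by rewrite !inE /= ve addbK eqxx.
Qed.

Definition agree u v c : {set edge H} :=
  [set e in star u :&: star v | s u e (+) s v e == c].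

(** An edge of the cover through [(u, a)] is determined by the edge [e] below it; if [e] also
    contains [v], it passes through [(v, b)] exactly when the signs of [e] at [u] and [v] differ by
    [a (+) b]. *)
Lemma card_cover_star u a v b :
  #|@star cover (u, a) :&: @star cover (v, b)| = #|agree u v (a (+) b)|.
Proof.
have inj : injective (fun e : edge H => (e, a (+) s u e)) by move=> e f [].
rewrite -(card_imset _ inj); apply: eq_card => -[e c].
apply/idP/imsetP => [|[f]]; rewrite !inE /=.
  move=> /andP[/andP[ue /eqP ha] /andP[ve /eqP hb]].
  exists e; last by congr pair; rewrite ha addbK.
  rewrite !inE ue ve /=; apply/eqP; rewrite ha hb.
  by case: c (s u e) (s v e) {ha hb} => [] [] [].
move=> /andP[/andP[uf vf] /eqP hf] [-> ->].
rewrite uf vf addbK eqxx /=; apply/eqP.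
by move: hf {inj}; case: a b (s u f) (s v f) => [] [] [] [].
Qed.

Lemma agree_self u : agree u u true = set0.
Proof. by apply/setP => e; rewrite !inE addbb andbF. Qed.

Lemma card_agree u v : (#|agree u v false| + #|agree u v true|)%N = #|star u :&: star v|.
Proof.
rewrite -(cardsID [set e | s u e (+) s v e == false] (star u :&: star v)); congr (_ + _)%N.
  by apply: eq_card => e; rewrite !inE.
by apply: eq_card => e; rewrite !inE andbC; case: (_ (+) _).
Qed.

Variable R : comNzRingType.

Definition signed_incidence : 'M[R]_(nu H, ne H) :=
  \matrix_(i, k) ((enum_val i \in verts (enum_val k))%:R
                   * (-1) ^+ s (enum_val i) (enum_val k)).

Lemma signed_gram i j :
  (signed_incidence *m signed_incidence^T) i j =
  #|agree (enum_val i) (enum_val j) false|%:R - #|agree (enum_val i) (enum_val j) true|%:R.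
Proof.
set u := enum_val i; set v := enum_val j.
transitivity (\sum_(e : edge H) ((u \in verts e)%:R * (v \in verts e)%:R
     * (-1) ^+ (s u e (+) s v e)) : R).
  rewrite mxE [RHS](reindex (@enum_val _ (edge H))) /=; last first.
    by apply: onW_bij; exact: enum_val_bij.
  apply: eq_bigr => k _; rewrite !mxE -/u -/v signr_addb.
  ring.
rewrite -!sum1_card !natr_sum [X in _ = X - _]big_mkcond [X in _ = _ - X]big_mkcond.
rewrite -sumrB /=; apply: eq_bigr => e _.
rewrite !inE; case: (u \in _); case: (v \in _); case: (_ (+) _) => /=; ring.
Qed.

(** Listed sheet by sheet, the adjacency matrix has a block [P] within each sheet and a block [Q]
    between sheets, and [P + Q], [P - Q] share out its spectrum. Subtracting [d] clears the diagonal
    of the signed Gram matrix, which holds the degrees. *)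
Lemma char_poly_cover d : (forall v : vertex H, #|star v| = d) ->
  char_poly (adjacency R cover) = char_poly (adjacency R H) *
    char_poly (signed_incidence *m signed_incidence^T - d%:R%:M).
Proof.
move=> deg.
pose lab (k : 'I_(nu H + nu H)) : vertex cover :=
  match split k with inl i => (enum_val i, false) | inr i => (enum_val i, true) end.
pose unlab (vb : vertex cover) : 'I_(nu H + nu H) :=
  if vb.2 then rshift _ (enum_rank vb.1) else lshift _ (enum_rank vb.1).
have lab_bij : bijective lab.
  exists unlab => [k|[v b]].
    rewrite /lab -[RHS]splitK; case: (split k) => i; rewrite /unlab /= enum_valK //.
  rewrite /lab /unlab; case: b => /=.
    by rewrite (unsplitK (inr _)) enum_rankK.
  by rewrite (unsplitK (inl _)) enum_rankK.
pose h k := enum_rank (lab k).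
have bh : bijective h by apply: bij_comp lab_bij; exact: enum_rank_bij.
rewrite -(char_poly_mxsub_bij (adjacency R cover) bh).
pose P : 'M[R]_(nu H) := \matrix_(i, j)
  if i == j then 0 else #|agree (enum_val i) (enum_val j) false|%:R.
pose Q : 'M[R]_(nu H) := \matrix_(i, j) #|agree (enum_val i) (enum_val j) true|%:R.
have -> : \matrix_(i, j) adjacency R cover (h i) (h j) = block_mx P Q Q P.
  apply/matrixP => i j; rewrite -(splitK i) -(splitK j).
  have hE k l : adjacency R cover (h k) (h l) =
      if k == l then 0 else #|agree (lab k).1 (lab l).1 ((lab k).2 (+) (lab l).2)|%:R.
    rewrite mxE (inj_eq (bij_inj bh)) /h !enum_rankK.
    by case: (lab k) (lab l) => u a [v b]; rewrite card_cover_star.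
  rewrite mxE hE /lab; case: (split i) => k; case: (split j) => l; rewrite !unsplitK /=.
  - by rewrite block_mxEul mxE (inj_eq (@lshift_inj _ _)).
  - by rewrite block_mxEur mxE eq_lrshift.
  - by rewrite block_mxEdl mxE eq_rlshift.
  - by rewrite block_mxEdr mxE (inj_eq (@rshift_inj _ _)).
have -> : adjacency R H = P + Q.
  apply/matrixP => i j; rewrite !mxE; case: eqP => [->|_]; last by rewrite -natrD card_agree.
  by rewrite agree_self cards0 addr0.
suff -> : signed_incidence *m signed_incidence^T - d%:R%:M = P - Q.
  exact: char_poly_block_circ.
apply/matrixP => i j.
rewrite [LHS]mxE signed_gram !mxE; case: eqP => [->|_]; last by rewrite oppr0 addr0.
have := card_agree (enum_val j) (enum_val j).
rewrite agree_self cards0 addn0 setIid deg => ->.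
by rewrite !subr0 mulr1n subrr.
Qed.

End Cover.

(** * Bounds on the new eigenvalues *)

Lemma gram_shift_roots (R : rcfType) n m (N : 'M[R]_(n, m)) (d c : R) :
  (forall x, - c < x -> 0 < \det (x%:M + N *m N^T)) ->
  exists s, [/\ size s = n, char_poly (N *m N^T - d%:M) = rootprod s &
                forall x, x \in s -> c - d <= x].
Proof.
move=> pos; pose M := d%:M - N *m N^T.
have sM : M^T = M by rewrite /M linearB /= tr_scalar_mx trmx_mul trmxK.
have cE : char_poly (N *m N^T - d%:M) = mixed_poly [::] M.
  by rewrite /mixed_poly /= /pencil /char_poly /char_poly_mx -map_mxN opprB.
have [s ss es] := mixed_poly_split (isT : nonempty_all [::]) sM.
rewrite /mixed_lead big_nil scale1r in es.
exists s; split=> //; first by rewrite cE.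
move=> x xs; rewrite leNgt; apply/negP => xc.
have : (mixed_poly [::] M).[x] = 0.
  by apply/eqP; rewrite es -[_ == 0]/(root _ _) root_prod_XsubC.
rewrite mixed_poly_horner /= /M addrA -(raddfD (@scalar_mx R n)) /= => det0.
(* An eigenvalue below [c - d] would make the determinant vanish at [- (x + d)], which exceeds
   [- c]. *)
have := pos (- (x + d)); have -> : - c < - (x + d) by lra.
move=> /(_ isT).
have -> : (- (x + d))%:M + N *m N^T = (-1) *: ((x + d)%:M - N *m N^T).
  by rewrite scaleN1r opprB [RHS]addrC (raddfN (@scalar_mx R n)).
by rewrite detZ det0 mulr0 ltxx.
Qed.

(** For [m < n], Sylvester's identity gives [- d] with multiplicity [n - m] besides the [m]
    eigenvalues of [N^T *m N - d%:M]. So at least [m] entries of the sorted list reach [c - d],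
    wherever [- d] falls. *)
Lemma gram_take_roots (R : rcfType) n m (N : 'M[R]_(n, m)) (d c : R) :
  (if (n <= m)%N then forall x, - c < x -> 0 < \det (x%:M + N *m N^T)
   else forall x, - c < x -> 0 < \det (x%:M + N^T *m N)) ->
  forall x, x \in take (minn n m) (real_roots (char_poly (N *m N^T - d%:M))) -> c - d <= x.
Proof.
case: leqP => nm pos.
  have [s [ss es cs]] := gram_shift_roots d pos.
  rewrite es => x /mem_take; rewrite (perm_mem (perm_real_roots_rootprod s)); exact: cs.
have [|s [ss es cs]] := @gram_shift_roots R m n N^T d c; first by rewrite trmxK.
rewrite trmxK in es.
have cE : char_poly (N *m N^T - d%:M) = rootprod (nseq (n - m) (- d)) * rootprod s.
  have cpE k l (B : 'M[R]_(k, l)) : char_poly (B *m B^T - d%:M) =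
      \det (('X + d%:P)%:M - map_mx polyC B *m (map_mx polyC B)^T).
    rewrite /char_poly /char_poly_mx map_mxB map_mxM map_trmx map_scalar_mx /=.
    by rewrite opprB addrA (raddfD (@scalar_mx {poly R} k)).
  have X0 : 'X + d%:P != 0 :> {poly R}.
    by rewrite -[d]opprK polyCN polyXsubC_eq0.
  have := det_scalar_sub_mulmx ('X + d%:P) (map_mx polyC N) (map_mx polyC N)^T.
  rewrite -cpE; have -> : \det (('X + d%:P)%:M - (map_mx polyC N)^T *m map_mx polyC N) = rootprod s.
    rewrite -es; have := cpE _ _ N^T; rewrite trmxK => ->.
    by rewrite -map_trmx trmxK.
  have -> : ('X + d%:P) ^+ n = ('X + d%:P) ^+ m * ('X + d%:P) ^+ (n - m).
    by rewrite -exprD subnKC // ltnW.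
  rewrite -mulrA => /(mulfI (expf_neq0 _ X0)) ->; congr (_ * _).
  by rewrite /rootprod big_nseq -Monoid.iteropE polyCN opprK.
apply: take_sorted_ge (real_roots_sorted _) _.
rewrite cE (seq.permP (perm_real_roots_mul (rootprod_neq0 _) (rootprod_neq0 _))) count_cat.
rewrite !(seq.permP (perm_real_roots_rootprod _)); apply: leq_trans (leq_addl _ _).
suff /eqP -> : count (>= (c - d)) s == size s by rewrite ss.
by rewrite -all_count; apply/allP => x; exact: cs.
Qed.

Lemma sqr_sqrt_diff (R : rcfType) (d r : nat) : (0 < d)%N -> (0 < r)%N ->
  `| Num.sqrt (d%:R - 1) - Num.sqrt (r%:R - 1) : R | ^+ 2 - d%:R =
  r%:R - 2 - 2 * Num.sqrt ((d%:R - 1) * (r%:R - 1)).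
Proof.
move=> d0 r0.
have d1 : 0 <= d%:R - 1 :> R by rewrite subr_ge0 ler1n.
have r1 : 0 <= r%:R - 1 :> R by rewrite subr_ge0 ler1n.
rewrite real_normK ?num_real // sqrrB !sqr_sqrtr // sqrtrM // -mulr_natl.
ring.
Qed.

(** The exponents of the matching sum count unmatched rows, so the rows must be the smaller side:
    the edges if they are fewer than the vertices. *)
Lemma exists_hypergraph_signing (R : rcfType) (H : hypergraph) (c : R) :
  (forall x, - c < x -> 0 < \sum_(A | is_matching (@hinc H) A) x ^+ (tau H - #|A|)) ->
  exists s : vertex H -> edge H -> bool, let N := signed_incidence s R in
  if (nu H <= ne H)%N then forall x, - c < x -> 0 < \det (x%:M + N *m N^T)
  else forall x, - c < x -> 0 < \det (x%:M + N^T *m N).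
Proof.
move=> pos; case: leqP => nm.
  pose inc (i : 'I_(nu H)) (k : 'I_(ne H)) := hinc (enum_val i) (enum_val k).
  have [|s hs] := @exists_signing R _ _ inc (- c).
    move=> x /pos; rewrite /tau (minn_idPl nm).
    rewrite (@sum_matching_bij _ _ _ _ _ inc _
      (fun a => (enum_val a.1, enum_val a.2)) (fun k => x ^+ (nu H - k))) //.
      exists (fun a => (enum_rank a.1, enum_rank a.2)) => -[a b] /=.
        by rewrite !enum_valK.
      by rewrite !enum_rankK.
    by move=> a b /=; rewrite !(inj_eq enum_val_inj).
  exists (fun v e => s (enum_rank v) (enum_rank e)) => N x xc; have := hs x xc.
  congr (0 < \det (_ + _ *m _)); last congr trmx.
    by apply/matrixP => i k; rewrite !mxE !enum_valK.
  by apply/matrixP => i k; rewrite !mxE !enum_valK.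
pose inc (k : 'I_(ne H)) (i : 'I_(nu H)) := hinc (enum_val i) (enum_val k).
have [|s hs] := @exists_signing R _ _ inc (- c).
  move=> x /pos; rewrite /tau (minn_idPr (ltnW nm)).
  rewrite (@sum_matching_bij _ _ _ _ _ inc _
    (fun a => (enum_val a.2, enum_val a.1)) (fun k => x ^+ (ne H - k))) //.
    exists (fun a => (enum_rank a.2, enum_rank a.1)) => -[a b] /=.
      by rewrite !enum_valK.
    by rewrite !enum_rankK.
  by move=> a b /=; rewrite !(inj_eq enum_val_inj) orbC.
exists (fun v e => s (enum_rank e) (enum_rank v)) => N x xc; have := hs x xc.
congr (0 < \det (_ + _ *m _)).
  by apply/matrixP => i k; rewrite !mxE !enum_valK.
by apply/matrixP => i k; rewrite !mxE !enum_valK.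
Qed.

Theorem theorem1p8 (R : realType) (H : hypergraph) (d r : nat)
    (Hreg : regular d r H)
    (Hroot : `| Num.sqrt (d%:R - 1) - Num.sqrt (r%:R - 1) : R |
             <= kth_largest_root (matching_poly (@incidence_graph H) R) (tau H)) :
  exists (Hbar : hypergraph)
         (p : vertex Hbar -> vertex H) (phi : edge Hbar -> edge H),
    left_sided_Ramanujan_2covering R d r p phi.
Proof.
have [r2 er vd] := Hreg; have r0 : (0 < r)%N by exact: ltnW.
(* Without vertices or without edges no new eigenvalue is non-obvious, and any 2-cover will do. *)
have [tau0|tau0] := posnP (tau H).
  exists (cover (fun _ _ => false)), fst, fst; split; first exact: cover_is_2cover.
  by move=> theta; rewrite /nonobvious_new_eigenvalues tau0 take0.
(* Square roots of negative numbers are 0 by convention, so the identity for the bound requires [d]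
   positive. *)
have d0 : (0 < d)%N.
  have /card_gt0P[e _] : (0 < ne H)%N by apply: leq_trans tau0 _; exact: geq_minr.
  have /card_gt0P[v ve] : (0 < #|verts e|)%N by rewrite er.
  by rewrite -(vd v); apply/card_gt0P; exists e; rewrite inE.
have pos := matching_sum_gt0 (normr_ge0 _) tau0 Hroot.
have [s hs] := exists_hypergraph_signing pos.
exists (cover s), fst, fst; split; first exact: cover_is_2cover.
(* The bound becomes [c - d], with [c] the square of the threshold in [Hroot]. *)
move=> theta; rewrite -(sqr_sqrt_diff R d0 r0).
rewrite /nonobvious_new_eigenvalues /new_eigenvalues /spectrum (char_poly_cover s R vd).
rewrite seq_diff_real_roots ?monic_neq0 ?char_poly_monic //.
exact: (gram_take_roots hs).
Qed.
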